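(* Let $\phi:\Omega\to\mathbb{R}$ be a continuous potential such that $\mathrm{var}_n(\phi)=O(n^{-\alpha})$ for some $\alpha>2$, and let $\mu_\phi$ be its unique equilibrium state. Then there exist strictly positive constants $c_1,c_2$ and $u_0$ such that, for all $n\ge1$ and all $u>u_0$, $$(\mu_\phi\otimes\mu_\phi)\Big\{(x,y):\ \frac1n\log T_{x^{0,n-1}}(y)\ge h(\mu_\phi)+u\Big\}\le c_1e^{-c_2nu^2}$$ and $$(\mu_\phi\otimes\mu_\phi)\Big\{(x,y):\ \frac1n\log T_{x^{0,n-1}}(y)\le h(\mu_\phi)-u\Big\}\le c_1e^{-c_2nu}.$$
   Context: $A$ is a finite alphabet, $\mathbb{N}=\{0,1,2,\dots\}$, $\Omega=A^{\mathbb{N}}$ with points $x=x^0x^1x^2\cdots$, and $T:\Omega\to\Omega$ is the shift $(Tx)^k=x^{k+1}$. For integers $i\le j$ write $x^{i,j}=x^ix^{i+1}\cdots x^j$. The variation of $\phi$ is $\mathrm{var}_n(\phi)=\sup\{|\phi(x)-\phi(y)|: x^i=y^i,\ 0\le i\le n-1\}$. The equilibrium state $\mu_\phi$ is the unique shift-invariant Borel probability measure maximizing $\nu\mapsto h(\nu)+\int\phi\,d\nu$ over shift-invariant probability measures, where $h(\nu)$ is the (Kolmogorov–Sinai) entropy of $\nu$ (natural logarithms). For $x,y\in\Omega$, the hitting time is $T_{x^{0,n-1}}(y)=\inf\{j\ge1: y^{j,j+n-1}=x^{0,n-1}\}$ (with $\inf\emptyset=+\infty$). *)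

(* Defs.v *)
From HB Require Import structures.
From mathcomp Require Import all_boot all_order all_algebra.
From mathcomp Require Import all_classical all_reals all_analysis.

Set Implicit Arguments.
Unset Strict Implicit.
Unset Printing Implicit Defensive.

Import Order.TTheory GRing.Theory Num.Theory.
Import numFieldNormedType.Exports.

Local Open Scope classical_set_scope.
Local Open Scope ring_scope.

(* Finite nonempty types. Nonemptiness of the alphabet excludes only the case
   where the full shift is empty and carries no probability measure at all; the
   chosen point is there because [measurableType] requires one. *)
#[short(type="pfinType")]
HB.structure Definition PointedFinite := {T of Finite T & Pointed T}.

Definition full_shift (A : pfinType) : Type :=
  prod_topology (fun _ : nat => discrete_topology A).

HB.instance Definition _ (A : pfinType) := Pointed.on (full_shift A).
HB.instance Definition _ (A : pfinType) := Topological.on (full_shift A).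

HB.instance Definition _ (A : pfinType) :=
  Measurable.copy (full_shift A) (g_sigma_algebraType (@open (full_shift A))).

Definition shift_map (A : pfinType) (x : full_shift A) : full_shift A :=
  fun k => x k.+1.

(* For a continuous (hence bounded) potential the set below is bounded, so that
   this real-valued [sup] is a genuine supremum. *)
Definition potential_var (R : realType) (A : pfinType) (phi : full_shift A -> R)
    (n : nat) : R :=
  sup [set r | exists x y : full_shift A,
    (forall i, (i < n)%N -> x i = y i) /\ r = `|phi x - phi y|].

Section entropy.
Context d (X : measurableType d) (R : realType).
Variables (T : X -> X) (mu : probability X R).

Definition invariant_measure : Prop :=
  forall B : set X, measurable B -> mu (T @^-1` B) = mu B.

(* Terms of measure zero contribute 0, since [ln 0 = 0]. *)
Definition shannon_entropy (I : finType) (Q : I -> set X) : R :=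
  - \sum_(i : I) fine (mu (Q i)) * ln (fine (mu (Q i))).

(* The atoms of P \/ T^-1 P \/ ... \/ T^-(n-1) P, indexed by the words of
   length n in the labels of P (empty atoms are harmless). *)
Definition join_iter (I : finType) (P : I -> set X) (n : nat)
    (w : {ffun 'I_n -> I}) : set X :=
  \bigcap_(i in [set: 'I_n]) (iter i T @^-1` P (w i)).

(* The limit exists by subadditivity whenever mu is T-invariant. *)
Definition partition_entropy (I : finType) (P : I -> set X) : R :=
  limn (fun n => n%:R^-1 * shannon_entropy (@join_iter I P n)).

Definition ks_entropy : \bar R :=
  ereal_sup [set e | exists k (P : 'I_k -> set X),
    [/\ forall i, measurable (P i), partition [set: 'I_k] P [set: X]
      & e = (partition_entropy P)%:E]].

End entropy.

Section equilibrium.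
Context (R : realType) (A : pfinType).
Variable phi : full_shift A -> R.

Definition free_energy (nu : probability (full_shift A) R) : \bar R :=
  (ks_entropy (@shift_map A) nu + \int[nu]_x (phi x)%:E)%E.

Definition equilibrium_state (mu : probability (full_shift A) R) : Prop :=
  invariant_measure (@shift_map A) mu /\
  forall nu : probability (full_shift A) R,
    invariant_measure (@shift_map A) nu -> (free_energy nu <= free_energy mu)%E.

Definition unique_equilibrium_state (mu : probability (full_shift A) R) : Prop :=
  equilibrium_state mu /\
  forall nu : probability (full_shift A) R, equilibrium_state nu ->
    forall B, measurable B -> nu B = mu B.

End equilibrium.

Definition hitting_time (R : realType) (A : pfinType) (n : nat)
    (x y : full_shift A) : \bar R :=
  ereal_inf [set j%:R%:E | j in [set j : nat |
    (1 <= j)%N /\ forall i, (i < n)%N -> y (j + i)%N = x i]].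

(* Main.v *)
(* The deviation u may be taken larger than any constant depending on the
   potential. As T >= 1 and the entropy is finite, the lower event is then
   empty. For the upper event it is enough that the equilibrium state sees
   every word of length n, conditionally on any past, with probability at least
   exp(-nb): waiting times then have doubly exponential tails in u, far below
   exp(-c n u^2).

   This lower bound is the Gibbs property. It is proved by building a Gibbs
   measure and identifying it with the equilibrium state. The iterates of the
   transfer operator have bounded distortion, so Cesaro means of the orbit
   averages L^(2N)(1_C o T^k)(x0) / L^(2N)1(x0), taken along an ultrafilter,
   give a shift-invariant finitely additive charge with the Gibbs property; by
   compactness it extends to a Borel probability. The Gibbs inequality for
   entropies, tested against the weights L^M(F)(x0) / L^M 1(x0), bounds the free
   energy of every invariant measure by the pressure P, and the Gibbs measure
   attains P. Uniqueness of the equilibrium state concludes. *)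
Require Import Defs.
From HB Require Import structures.
From mathcomp Require Import all_boot all_order all_algebra.
From mathcomp Require Import all_classical all_reals all_analysis.
From mathcomp Require Import measurable_realfun ring lra zify.

Set Implicit Arguments.
Unset Strict Implicit.
Unset Printing Implicit Defensive.

Import Order.TTheory GRing.Theory Num.Theory.
Import numFieldNormedType.Exports.

Local Open Scope classical_set_scope.
Local Open Scope ring_scope.

(** * Cylinders, and maps that depend on finitely many coordinates *)

Section words.
Context (A : pfinType).
Implicit Types x y z : full_shift A.

Definition agree n x y := forall i, (i < n)%N -> x i = y i.

Definition scons (a : A) x : full_shift A :=
  fun k => if k is k'.+1 then x k' else a.

(** The arbitrary codomain lets one predicate cover real functions and sets, the latter as functions
    into [Prop]; the sets that satisfy it for some [n] are the clopen ones. *)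
Definition depends_on n B (f : full_shift A -> B) :=
  forall x y, agree n x y -> f x = f y.

Lemma agree_refl n x : agree n x x. Proof. by []. Qed.

Lemma agree_sym n x y : agree n x y -> agree n y x.
Proof. by move=> xy i /xy. Qed.

Lemma agree_trans n x y z : agree n x y -> agree n y z -> agree n x z.
Proof. by move=> xy yz i ni; rewrite xy// yz. Qed.

Lemma agree_le m n x y : (m <= n)%N -> agree n x y -> agree m x y.
Proof. by move=> mn xy i im; apply: xy; exact: leq_trans mn. Qed.

Lemma agree_scons n (a : A) x y :
  agree n x y -> agree n.+1 (scons a x) (scons a y).
Proof. by move=> xy [|i]//= ni; exact: xy. Qed.

Lemma scons_shift x : scons (x 0%N) (shift_map x) = x.
Proof. by apply/funext => -[]. Qed.

Lemma iter_shiftE n x k : iter n (@shift_map A) x k = x (n + k)%N.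
Proof. by elim: n k => // n ih k; rewrite iterS /shift_map ih addnS addSn. Qed.

Lemma agree_iter_shift m n x y : agree (m + n) x y ->
  agree n (iter m (@shift_map A) x) (iter m (@shift_map A) y).
Proof. by move=> xy i ni; rewrite !iter_shiftE xy// ltn_add2l. Qed.

Lemma depends_on_le m n B (f : full_shift A -> B) : (m <= n)%N ->
  depends_on m f -> depends_on n f.
Proof. by move=> mn fm x y /(agree_le mn)/fm. Qed.

Lemma depends_on_comp_shift m n B (f : full_shift A -> B) :
  depends_on n f -> depends_on (m + n) (f \o iter m (@shift_map A)).
Proof. by move=> fn x y /agree_iter_shift/fn. Qed.

Lemma depends_on_agree n x : depends_on n (agree n x).
Proof.
move=> y z yz; apply/propext; split => [xy|xz].
  exact: agree_trans xy yz.
exact: agree_trans xz (agree_sym yz).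
Qed.

Lemma agree_eql n x y : agree n x y -> agree n x = agree n y.
Proof.
move=> xy; apply/funext => z; apply/propext; split => [xz|yz].
  exact: agree_trans (agree_sym xy) xz.
exact: agree_trans xy yz.
Qed.

Lemma depends_on_indic (R : pzRingType) n (C : set (full_shift A)) :
  depends_on n C -> depends_on n (\1_C : _ -> R).
Proof.
move=> nC x y /nC Cxy; rewrite !indicE; congr (nat_of_bool _)%:R.
by apply/idP/idP; rewrite !inE Cxy.
Qed.

End words.

(** * Iterates of the transfer operator and their distortion *)

Section transfer_operator.
Context (R : realType) (A : pfinType) (phi : full_shift A -> R).
Implicit Types (x y z : full_shift A) (F G : full_shift A -> R).
Notation T := (@shift_map A).

Definition birkhoff n x : R := \sum_(i < n) phi (iter i T x).

Definition preimage_sum F x : R := \sum_(a : A) F (scons a x).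

(** The [n]-th iterate of the Ruelle operator, with the weights of all [n] steps collected in one
    exponential; [transferD] recovers the semigroup law. *)
Definition transfer n F : full_shift A -> R :=
  iter n preimage_sum (fun z => expR (birkhoff n z) * F z).

Lemma birkhoffD m n x :
  birkhoff (m + n) x = birkhoff m x + birkhoff n (iter m T x).
Proof.
rewrite /birkhoff big_split_ord/=; congr (_ + _).
by apply: eq_bigr => i _; rewrite -iterD addnC.
Qed.

(** Prefixing the same word of length [n] to [x] and to [y] gives two points that agree on [n]
    coordinates, so the sums compare term by term. *)
Lemma iter_preimage_sum_le n F G x y :
  (forall z z', agree n z z' -> F z <= G z') ->
  iter n preimage_sum F x <= iter n preimage_sum G y.
Proof.
elim: n F G => [|n ih] F G FG; first exact: FG.
rewrite !iterSr; apply: ih => z z' zz'; apply: ler_sum => a _.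
exact/FG/agree_scons.
Qed.

(** One term is kept: the preimage of [x] that starts with the first [n] letters of [z]. *)
Lemma iter_preimage_sum_point n F c x z : (forall z, 0 <= F z) ->
  (forall z', agree n z z' -> c <= F z') -> c <= iter n preimage_sum F x.
Proof.
elim: n F z => [|n ih] F z F0 Fc; first exact: Fc.
rewrite iterSr; apply: (ih _ (T z)) => [z'|z' zz']; first exact: sumr_ge0.
rewrite /preimage_sum (bigD1 (z 0%N))//= -[leLHS]addr0 lerD//.
  by apply: Fc; rewrite -{1}(scons_shift z); exact: agree_scons.
exact: sumr_ge0.
Qed.

(** [iter n T] sends every preimage in the sum back to [x], so the second factor is constant. *)
Lemma iter_preimage_sum_comp n F G x :
  iter n preimage_sum (fun z => F z * G (iter n T z)) x =
  iter n preimage_sum F x * G x.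
Proof.
elim: n F x => // n ih F x; rewrite !iterSr -ih.
congr (iter n preimage_sum _ x).
apply/funext => z; rewrite /preimage_sum mulr_suml; apply: eq_bigr => a _.
by rewrite iterSr.
Qed.

Lemma iter_preimage_sumZ n c F x :
  iter n preimage_sum (fun z => c * F z) x = c * iter n preimage_sum F x.
Proof.
elim: n F => // n ih F; rewrite !iterSr -ih.
congr (iter n preimage_sum _ x).
by apply/funext => z; rewrite /preimage_sum mulr_sumr.
Qed.


(** By the cocycle identity [birkhoffD], the weight of the last [n] steps depends only on the image
    under [iter m T] and leaves the inner sum. *)
Lemma transferD m n F : transfer (m + n) F = transfer n (transfer m F).
Proof.
apply/funext => x; rewrite /transfer addnC iterD.
congr (iter n preimage_sum _ x); apply/funext => z.
rewrite [RHS]mulrC -(iter_preimage_sum_comp m _ (fun z => expR (birkhoff n z))).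
congr (iter m preimage_sum _ z).
by apply/funext => t; rewrite addnC birkhoffD expRD; ring.
Qed.

Lemma transfer0 F : transfer 0 F = F.
Proof.
by apply/funext => x; rewrite /transfer/= /birkhoff big_ord0 expR0 mul1r.
Qed.

Lemma transfer_comp n F x :
  transfer n (F \o iter n T) x = transfer n (cst 1) x * F x.
Proof.
rewrite -iter_preimage_sum_comp; congr (iter n preimage_sum _ x).
by apply/funext => z; rewrite mulr1.
Qed.

Lemma transfer_mul_comp n F G x :
  transfer n (fun z => F z * G (iter n T z)) x = transfer n F x * G x.
Proof.
rewrite -iter_preimage_sum_comp; congr (iter n preimage_sum _ x).
by apply/funext => z; rewrite mulrA.
Qed.

Lemma transferZ n c F x : transfer n (fun z => c * F z) x = c * transfer n F x.
Proof.
rewrite -iter_preimage_sumZ; congr (iter n preimage_sum _ x).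
by apply/funext => z; rewrite mulrCA.
Qed.

Lemma iter_preimage_sum_sum n (I : Type) (r : seq I) (P : pred I)
    (F : I -> full_shift A -> R) x :
  iter n preimage_sum (fun z => \sum_(i <- r | P i) F i z) x =
  \sum_(i <- r | P i) iter n preimage_sum (F i) x.
Proof.
elim: n F => // n ih F; rewrite iterSr (_ : preimage_sum _ =
    fun z => \sum_(i <- r | P i) preimage_sum (F i) z).
  by rewrite ih; apply: eq_bigr => i _; rewrite iterSr.
by apply/funext => z; rewrite /preimage_sum exchange_big.
Qed.

Lemma transfer_sum n (I : Type) (r : seq I) (P : pred I)
    (F : I -> full_shift A -> R) x :
  transfer n (fun z => \sum_(i <- r | P i) F i z) x =
  \sum_(i <- r | P i) transfer n (F i) x.
Proof.
rewrite -iter_preimage_sum_sum; congr (iter n preimage_sum _ x).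
by apply/funext => z; rewrite mulr_sumr.
Qed.

Lemma ler_iter_preimage_sum n F G x : (forall z, F z <= G z) ->
  iter n preimage_sum F x <= iter n preimage_sum G x.
Proof.
elim: n F G => [|n ih] F G FG; first exact: FG.
by rewrite !iterSr; apply: ih => z; exact: ler_sum.
Qed.

Lemma ler_transfer n F G x : (forall z, F z <= G z) ->
  transfer n F x <= transfer n G x.
Proof.
by move=> FG; apply: ler_iter_preimage_sum => z; rewrite ler_pM2l ?expR_gt0.
Qed.

Lemma transfer_ge0 n F x : (forall z, 0 <= F z) -> 0 <= transfer n F x.
Proof.
move=> F0; apply: le_trans (ler_transfer _ _ F0).
by under [X in transfer _ X]eq_fun do rewrite -[0](mul0r 0); rewrite transferZ mul0r.
Qed.


Section distortion.
Variable V : R.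
Hypothesis distortion :
  forall n x y, agree n x y -> birkhoff n x <= birkhoff n y + V.

Let distortionC n x y : agree n x y -> birkhoff n x - V <= birkhoff n y.
Proof. by move/distortion; lra. Qed.

Lemma transfer_distortion n F x y : (forall z, 0 <= F z) -> depends_on n F ->
  transfer n F x <= expR V * transfer n F y.
Proof.
move=> F0 nF; rewrite -iter_preimage_sumZ; apply: iter_preimage_sum_le.
move=> z z' zz'; rewrite (nF _ _ zz') mulrA -expRD ler_wpM2r// ler_expR.
by have := distortion zz'; lra.
Qed.

Lemma transfer_cylinder_ge n F x z : (forall z, 0 <= F z) -> depends_on n F ->
  expR (birkhoff n z - V) * F z <= transfer n F x.
Proof.
move=> F0 nF; apply: (@iter_preimage_sum_point n _ _ x z).
  by move=> t; rewrite mulr_ge0// expR_ge0.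
by move=> z' zz'; rewrite (nF _ _ zz') ler_wpM2r// ler_expR distortionC.
Qed.

Lemma transfer1_gt0 n x : 0 < transfer n (cst 1) x.
Proof.
apply: (lt_le_trans (expR_gt0 (birkhoff n x - V))).
by have := @transfer_cylinder_ge n (cst 1) x x; rewrite mulr1; apply.
Qed.


Variable x0 : full_shift A.
Local Notation Z n := (transfer n (cst 1) x0).

(** The operator is applied for [k], then [m], then [r] steps. The first stage only produces the
    factor [transfer k (cst 1)]. Moving this factor and then [transfer m F] to the base point [x0]
    costs [expR V] each time. *)
Lemma transfer_shift k m r F : (forall z, 0 <= F z) -> depends_on m F ->
  transfer (k + m + r) (F \o iter k T) x0
    <= expR V ^+ 2 * (Z k * transfer m F x0 * Z r) /\
  Z k * transfer m F x0 * Z r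
    <= expR V ^+ 2 * transfer (k + m + r) (F \o iter k T) x0.
Proof.
move=> F0 mF; set D := expR V.
have D0 : 0 < D by exact: expR_gt0.
have Z0 n : 0 < Z n by exact: transfer1_gt0.
have LF0 z : 0 <= transfer m F z by exact: transfer_ge0.
rewrite !transferD; split.
  apply: (@le_trans _ _ (transfer r (fun=> D ^+ 2 * Z k * transfer m F x0 * 1) x0)).
    apply: ler_transfer => z; apply: (@le_trans _ _ (D * Z k * transfer m F z)).
      rewrite -transferZ; apply: ler_transfer => t; rewrite transfer_comp.
      by rewrite ler_wpM2r// transfer_distortion.
    rewrite (_ : _ * 1 = D * Z k * (D * transfer m F x0)); last by ring.
    by rewrite ler_pM2l ?mulr_gt0// transfer_distortion.
  by rewrite transferZ le_eqVlt; apply/orP; left; apply/eqP; ring.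
rewrite -[leRHS]transferZ.
apply: (@le_trans _ _ (transfer r (fun=> Z k * transfer m F x0 * 1) x0)).
  by rewrite (transferZ _ (_ * _)).
apply: ler_transfer => z; apply: (@le_trans _ _ (D * Z k * transfer m F z)).
  rewrite [leRHS](_ : _ = Z k * (D * transfer m F z)); last by ring.
  by rewrite mulr1 ler_pM2l// transfer_distortion.
rewrite expr2 -!mulrA ler_pM2l// -[leLHS]transferZ -[leRHS]transferZ.
apply: ler_transfer => t.
rewrite transfer_comp mulrA ler_wpM2r//.
exact: transfer_distortion.
Qed.

Lemma transfer1D_bounds m n :
  `|ln (Z (m + n)) - ln (Z m) - ln (Z n)| <= 2 * V.
Proof.
have Z0 n' : 0 < Z n' by exact: transfer1_gt0.
have F0 (z : full_shift A) : 0 <= (cst 1 : full_shift A -> R) z by rewrite /=.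
have [] := @transfer_shift m n 0 (cst 1) F0 (fun _ _ _ => erefl).
have ->: cst 1 \o iter m T = cst 1 :> (full_shift A -> R) by [].
rewrite addn0 transfer0 mulr1 -expRM_natl => h1 h2.
have D0 : 0 < expR (2 * V) by exact: expR_gt0.
have := Z0 m; have := Z0 n; have := Z0 (m + n)%N => Zmn Zn Zm.
rewrite -ler_ln ?posrE ?mulr_gt0// !lnM ?posrE ?mulr_gt0// expRK in h1.
rewrite -ler_ln ?posrE ?mulr_gt0// !lnM ?posrE ?mulr_gt0// expRK in h2.
by rewrite ler_norml; apply/andP; split; lra.
Qed.

(** Quotient of [transfer_shift] for [F] by [transfer_shift] for the constant 1; each contributes
    [expR V ^+ 2]. *)
Lemma transfer_ratio k m r F : (forall z, 0 <= F z) -> depends_on m F ->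
  transfer (k + m + r) (F \o iter k T) x0 / Z (k + m + r)
    <= expR V ^+ 4 * (transfer m F x0 / Z m) /\
  transfer m F x0 / Z m
    <= expR V ^+ 4 * (transfer (k + m + r) (F \o iter k T) x0 / Z (k + m + r)).
Proof.
move=> F0 mF; have D0 : 0 < expR V by exact: expR_gt0.
have Z0 n' : 0 < Z n' by exact: transfer1_gt0.
have I0 (z : full_shift A) : 0 <= (cst 1 : full_shift A -> R) z by rewrite /=.
have [h1 h2] := transfer_shift k r F0 mF.
have [] := @transfer_shift k m r (cst 1) I0 (fun _ _ _ => erefl).
have ->: cst 1 \o iter k T = cst 1 :> (full_shift A -> R) by [].
move=> h3 h4.
have LF0 : 0 <= transfer m F x0 by exact: transfer_ge0.
split.
  rewrite ler_pdivrMr// -mulrA mulrCA mulrAC mulrA ler_pdivlMr//.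
  apply: (@le_trans _ _ (expR V ^+ 2 * (Z k * transfer m F x0 * Z r) * Z m)).
    by rewrite ler_pM2r.
  rewrite [leLHS](_ : _ =
    expR V ^+ 2 * transfer m F x0 * (Z k * Z m * Z r)); last by ring.
  rewrite [leRHS](_ : _ =
      expR V ^+ 2 * transfer m F x0 * (expR V ^+ 2 * Z (k + m + r))).
    by rewrite ler_wpM2l// mulr_ge0// exprn_ge0// ltW.
  by ring.
rewrite ler_pdivrMr// mulrA mulrAC ler_pdivlMr//.
apply: (@le_trans _ _ (transfer m F x0 * (expR V ^+ 2 * (Z k * Z m * Z r)))).
  by rewrite ler_wpM2l.
rewrite [leLHS](_ : _ =
  expR V ^+ 2 * Z m * (Z k * transfer m F x0 * Z r)); last by ring.
rewrite [leRHS](_ : _ = expR V ^+ 2 * Z m *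
  (expR V ^+ 2 * transfer (k + m + r) (F \o iter k T) x0)); last by ring.
by rewrite ler_pM2l// mulr_gt0 ?exprn_gt0.
Qed.

End distortion.

End transfer_operator.

(** * Almost additive sequences and limits along an ultrafilter *)

Section limits_of_real_sequences.
Context (R : realType).
Implicit Types (a : nat -> R).

(** [P] is the supremum of the quotients [(a m - C) / m] over positive [m]. Each lies below every
    [(a n + C) / n], as comparing [a (m * n)] with [m * a n] and with [n * a m] shows. *)
Lemma quasi_additive_rate a C :
  (forall m n, `|a (m + n)%N - a m - a n| <= C) ->
  exists P, forall n, `|a n - n%:R * P| <= C.
Proof.
move=> aC.
have aM n k : `|a (k.+1 * n)%N - k.+1%:R * a n| <= k%:R * C.
  elim: k => [|k ih]; first by rewrite mul1n mul1r mul0r subrr normr0.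
  rewrite mulSn (_ : _ - _ = (a (n + k.+1 * n)%N - a n - a (k.+1 * n)%N) +
    (a (k.+1 * n)%N - k.+1%:R * a n)); last by rewrite -natr1; ring.
  apply: le_trans (ler_normD _ _) _.
  rewrite -[in leRHS]natr1 mulrDl mul1r addrC; exact: lerD.
have C0 : 0 <= C by exact: le_trans (aC 0 0)%N.
have cross m n : (a m.+1 - C) / m.+1%:R <= (a n.+1 + C) / n.+1%:R.
  rewrite ler_pdivrMr// mulrAC ler_pdivlMr//.
  have := aM m.+1 n; have := aM n.+1 m; rewrite mulnC.
  rewrite !ler_norml => /andP[h1 h2] /andP[h3 h4].
  have : n%:R * C <= n.+1%:R * C by rewrite ler_wpM2r// ler_nat.
  have : m%:R * C <= m.+1%:R * C by rewrite ler_wpM2r// ler_nat.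
  by nra.
pose E := [set (a m.+1 - C) / m.+1%:R | m in [set: nat]].
have ubE n : ubound E ((a n.+1 + C) / n.+1%:R) by move=> _ [m _ <-].
exists (sup E) => -[|n].
  by have := aC 0%N 0%N; rewrite addn0 subrr sub0r normrN mul0r subr0.
have : (a n.+1 - C) / n.+1%:R <= sup E.
  by apply: sup_ubound; [exists ((a 1 + C) / 1)%N; exact: (ubE 0)|exists n].
have : sup E <= (a n.+1 + C) / n.+1%:R.
  by apply: ge_sup => //; exists ((a 1 - C) / 1)%N; exists 0%N.
rewrite ler_pdivrMr// ler_pdivlMr// => h1 h2.
by rewrite ler_norml; apply/andP; split; lra.
Qed.

(** A sequence in [[0, 1]] has a cluster point along [U] by compactness, and along an ultrafilter a
    cluster point is a limit. A single [U] serves all sequences, which makes the limits additive. *)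
Lemma ultralimit_exists : exists U : set_system nat, [/\ ProperFilter U,
  \oo `<=` U & forall a, (forall n, 0 <= a n <= 1) -> cvg (a @ U)].
Proof.
have [U [UU ooU]] := @ultraFilterLemma nat \oo _.
have PU : ProperFilter U by exact: ultra_proper.
exists U; split=> // a a01.
have Ua : (a @ U) `[0, 1]%classic.
  by apply: (@filterE _ U) => n; rewrite /= in_itv/=; exact: a01.
have [l [_ cl]] := @segment_compact R 0 1 (a @ U) (fmap_proper_filter a PU) Ua.
apply/cvg_ex; exists l => B lB.
have [//|UB] := in_ultra_setVsetC (a @^-1` B) UU.
by have [z []] := cl _ _ (UB : (a @ U) (~` B)) lB.
Qed.

End limits_of_real_sequences.

(** * Construction of an invariant finitely additive Gibbs charge *)

Section gibbs_charge.
Context (R : realType) (A : pfinType) (phi : full_shift A -> R) (V : R).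
Hypothesis distortion :
  forall n x y, agree n x y -> birkhoff phi n x <= birkhoff phi n y + V.
Variable x0 : full_shift A.
Notation T := (@shift_map A).
Notation Z n := (transfer phi n (cst 1) x0).
Implicit Types C : set (full_shift A).

(** The probability of being in [C] at time [k] when the preimages of [x0] under [iter n T] are
    weighted by the exponential of their Birkhoff sums. *)
Let visit C n k : R := transfer phi n (\1_C \o iter k T) x0 / Z n.

Let indic01 C z : 0 <= (\1_C z : R) <= 1.
Proof. by rewrite indicE; case: (_ \in _); rewrite ?lexx ?ler01. Qed.

Let Z_gt0 n : 0 < Z n. Proof. exact: transfer1_gt0 distortion _ _. Qed.

Let visit01 C n k : 0 <= visit C n k <= 1.
Proof.
apply/andP; split.
  apply: divr_ge0; last exact/ltW/Z_gt0.
  apply: transfer_ge0 => z.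
  by have /andP[] := indic01 C (iter k T z).
rewrite ler_pdivrMr// mul1r; apply: ler_transfer => z.
by have /andP[] := indic01 C (iter k T z).
Qed.

Let visitT n k : visit setT n k = 1.
Proof.
rewrite /visit (_ : _ \o _ = cst 1) ?divff ?gt_eqF//.
by apply/funext => z; rewrite /= indicT.
Qed.

Let visitU C C' n k : [disjoint C & C'] ->
  visit (C `|` C') n k = visit C n k + visit C' n k.
Proof.
move=> CC'; rewrite /visit -mulrDl; congr (_ / _).
have := transfer_sum phi n (index_enum bool) predT
  (fun b => (\1_(if b then C else C') : _ -> R) \o iter k T) x0.
rewrite big_bool => <-; congr (transfer _ _ _ _); apply/funext => z /=.
rewrite big_bool/= !indicE in_setU.
case: (boolP (_ \in C)) => [zC|] /=; last by rewrite add0r.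
case: (boolP (_ \in C')) => [zC'|] /=; last by rewrite addr0.
by move/disj_setPS : CC' => /(_ (iter k T z)) []; split; exact: set_mem.
Qed.

Let visit_shift C n k : visit (T @^-1` C) n k = visit C n k.+1.
Proof. by []. Qed.

(** The horizon is twice the averaging window: after any time of the window more than [N.+1] steps
    remain, enough for [transfer_ratio] with a set of [m <= N] coordinates. *)
Let freq C N : R := N.+1%:R^-1 * \sum_(k < N.+1) visit C (N.+1 + N.+1) k.

Let freq_bounds C N (a b : R) :
  (forall k, (k < N.+1)%N -> a <= visit C (N.+1 + N.+1) k <= b) ->
  a <= freq C N <= b.
Proof.
move=> ab; rewrite /freq mulrC ler_pdivlMr// ler_pdivrMr//.
have cN (c : R) : c * N.+1%:R = \sum_(k < N.+1) c.
  by rewrite sumr_const card_ord mulr_natr.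
rewrite !cN.
by apply/andP; split; apply: ler_sum => k _; have /andP[] := ab _ (ltn_ord k).
Qed.

Lemma gibbs_charge : exists p : set (full_shift A) -> R,
  [/\ forall C, 0 <= p C, p setT = 1,
      forall C C', [disjoint C & C'] -> p (C `|` C') = p C + p C',
      forall C, p (T @^-1` C) = p C &
      forall m C, depends_on m C ->
        p C <= expR V ^+ 4 * (transfer phi m \1_C x0 / Z m) /\
        transfer phi m \1_C x0 / Z m <= expR V ^+ 4 * p C].
Proof.
have [U [PU ooU cvgU]] := ultralimit_exists R.
have cfreq C : cvg (freq C @ U).
  by apply: cvgU => N; apply: freq_bounds => k _; exact: visit01.
exists (fun C => lim (freq C @ U)); split.
- move=> C; apply: limr_ge => //; apply: filterE => N.
  by have /andP[] := @freq_bounds C N 0 1 (fun k _ => visit01 C _ k).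
- rewrite (_ : freq _ = cst 1) ?lim_cst//; apply/funext => N.
  apply/eqP; rewrite eq_le andbC; apply: (@freq_bounds _ N 1 1) => k _.
  by rewrite visitT lexx.
- move=> C C' CC'; suff -> : freq (C `|` C') = freq C + freq C'.
    exact: limD.
  apply/funext => N; rewrite [RHS](_ : _ = freq C N + freq C' N)//.
  rewrite /freq -mulrDr -big_split/=; congr (_ * _).
  by apply: eq_bigr => k _; exact: visitU.
(* Taking the preimage of [C] moves the window by one unit of time. The averages then differ by two
   boundary terms in [[0, 1]], hence by at most [1 / N.+1]. *)
- move=> C; apply/subr0_eq; rewrite -limB//; apply/cvg_lim => //.
  have harmonicU : @harmonic R @ U --> (0 : R).
    by move=> B /(@cvg_harmonic R)/ooU.
  apply: (squeeze_cvgr (f := - @harmonic R) (h := @harmonic R)) => //; last first.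
    by rewrite -[X in _ --> X]oppr0; exact: cvgN.
  apply: filterE => N /=; rewrite -ler_norml.
  rewrite [X in `|X|](_ : _ = freq (T @^-1` C) N - freq C N)// /freq -mulrBr.
  rewrite big_ord_recr [X in _ - X]big_ord_recl/= visit_shift.
  rewrite (_ : _ - _ = visit C (N.+1 + N.+1) N.+1 - visit C (N.+1 + N.+1) 0).
    rewrite normrM ger0_norm// -[leRHS]mulr1 ler_wpM2l// ler_norml.
    have := visit01 C (N.+1 + N.+1) N.+1; have := visit01 C (N.+1 + N.+1) 0.
    by move=> /andP[? ?] /andP[? ?]; apply/andP; split; lra.
  by rewrite (eq_bigr (fun k : 'I_N => visit C (N.+1 + N.+1) (bump 0 k))) //; ring.
- move=> m C mC.
  have D0 : 0 < expR V ^+ 4 by rewrite exprn_gt0 ?expR_gt0.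
  have Uf : \forall N \near U,
      (expR V ^+ 4)^-1 * (transfer phi m \1_C x0 / Z m) <= freq C N
      <= expR V ^+ 4 * (transfer phi m \1_C x0 / Z m).
    apply: ooU; exists m => // N /= mN; apply: freq_bounds => k kN.
    have -> : (N.+1 + N.+1 = k + m + (N.+1 + N.+1 - (k + m)))%N.
      by rewrite subnKC// leq_add// ltnW.
    have C0 z : 0 <= \1_C z :> R by have /andP[] := indic01 C z.
    have [h1 h2] := transfer_ratio distortion x0 k (N.+1 + N.+1 - (k + m))
      C0 (depends_on_indic R mC).
    by rewrite h1 andbT ler_pdivrMl.
  split.
    by apply: limr_le => //; apply: filterS Uf => N /andP[].
  rewrite -ler_pdivrMl//.
  by apply: limr_ge => //; apply: filterS Uf => N /andP[].
Qed.

End gibbs_charge.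

(** * Cylinders generate the topology and the Borel sets *)

Section cylinder_topology.
Context (A : pfinType).
Implicit Types (x y : full_shift A) (B C : set (full_shift A)).
Notation T := (@shift_map A).

Lemma nbhs_agree n x : nbhs x (agree n x).
Proof.
have nx i : nbhs x [set y : full_shift A | y i = x i].
  have /= c := @proj_continuous nat (fun=> discrete_topology A) i x.
  by apply: (c [set x i]); rewrite nbhs_principalE.
elim: n => [|n ih]; first by apply: filterE => y i.
apply: filterS (filterI ih (nx n)) => y [xy xyn] i.
by rewrite ltnS leq_eqVlt => /predU1P[->|/xy].
Qed.

(** The filter generated by the cylinders at [x] converges to [x] in every coordinate, hence in the
    product topology. *)
Lemma nbhs_agreeP x B : nbhs x B -> exists n, agree n x `<=` B.
Proof.
pose F := filter_from [set: nat] (fun n => agree n x).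
have FF : Filter F.
  apply: filter_from_filter; first by exists 0%N.
  move=> m n _ _; exists (maxn m n) => // y xy; split.
    exact: agree_le (leq_maxl _ _) xy.
  exact: agree_le (leq_maxr _ _) xy.
suff : F --> x by move=> Fx /Fx [n _ ?]; exists n.
apply/cvg_sup => i; apply/cvg_image.
  rewrite eqEsubset; split=> // a _; exists (fun=> a) => //.
move=> a; rewrite nbhs_principalE => /principal_filterP xa.
exists [set y | a (y i)].
  by exists i.+1 => // y xy /=; rewrite -xy.
rewrite eqEsubset; split=> [b [y ay <-]//|b ab].
by exists (fun=> b).
Qed.

Lemma depends_on_open n C : depends_on n C -> open C.
Proof.
move=> nC; rewrite openE => x Cx; apply: filterS (nbhs_agree n x) => y.
by move=> /nC <-.
Qed.

Lemma depends_on_measurable n C : depends_on n C -> measurable C.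
Proof. by move=> /depends_on_open oC; exact: sub_sigma_algebra. Qed.

(** The union is countable, so the clopen sets generate the Borel sigma-algebra. *)
Lemma open_bigcup_depends_on (O : set (full_shift A)) : open O ->
  exists C : nat -> set (full_shift A),
    (forall n, depends_on n (C n)) /\ O = \bigcup_n C n.
Proof.
move=> oO; exists (fun n => [set x | agree n x `<=` O]); split.
  by move=> n x y xy; rewrite /= (agree_eql xy).
rewrite eqEsubset; split=> [x Ox|x [n _]]; last by apply; exact: agree_refl.
have [n xO] := nbhs_agreeP (open_nbhs_nbhs (conj oO Ox)).
by exists n.
Qed.

Lemma measurable_full_shiftE :
  @measurable _ (full_shift A) = <<s [set C | exists n, depends_on n C] >>.
Proof.
rewrite eqEsubset; split.
  apply: smallest_sub; first exact: smallest_sigma_algebra.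
  move=> O /open_bigcup_depends_on [C [nC ->]].
  by apply: sigma_algebra_bigcup => n; apply: sub_sigma_algebra; exists n.
apply: smallest_sub; first exact: sigma_algebra_measurable.
by move=> C [n]; exact: depends_on_measurable.
Qed.

Lemma full_shift_compact : compact [set: full_shift A].
Proof.
have c (_ : nat) : compact [set: discrete_topology A].
  exact/finite_compact/finite_finset.
have := @tychonoff nat (fun=> discrete_topology A) (fun=> setT) c.
by rewrite (_ : [set f | _] = setT)// eqEsubset.
Qed.

Lemma measurable_shift : measurable_fun setT T.
Proof.
apply: (measurability _ measurable_full_shiftE) => _ [C [n nC] <-].
rewrite setTI; apply: (@depends_on_measurable n.+1) => x y xy.
by rewrite /preimage/=; apply: nC => i ni; exact: xy.
Qed.

End cylinder_topology.

(* The algebra of clopen sets, on the same carrier as the shift space. *)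
Definition clopen_space (A : pfinType) : Type := full_shift A.

Section clopen_algebra.
Context (A : pfinType).

Let clopen := [set C : set (full_shift A) | exists n, depends_on n C].

Let clopen0 : clopen set0. Proof. by exists 0%N. Qed.

Let clopenU : setU_closed clopen.
Proof.
move=> C C' [m mC] [n nC']; exists (maxn m n) => x y xy.
congr (_ \/ _); first exact/mC/(agree_le (leq_maxl _ _) xy).
exact/nC'/(agree_le (leq_maxr _ _) xy).
Qed.

Let clopenC : setC_closed clopen.
Proof. by move=> C [n nC]; exists n => x y xy; congr (~ _); exact: nC. Qed.

HB.instance Definition _ := Pointed.on (clopen_space A).
HB.instance Definition _ := isAlgebraOfSets.Build default_measure_display
  (clopen_space A) clopen0 clopenU clopenC.

End clopen_algebra.

(** * From a charge on clopen sets to a Borel probability *)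

Section charge_extension.
Context (R : realType) (A : pfinType).
Variable p : set (full_shift A) -> R.
Hypothesis p_ge0 : forall C, 0 <= p C.
Hypothesis pT : p setT = 1.
Hypothesis pU : forall C C', [disjoint C & C'] -> p (C `|` C') = p C + p C'.

Let m : set (clopen_space A) -> \bar R := EFin \o p.

Let p0 : p set0 = 0.
Proof.
have /pU : [disjoint (set0 : set (full_shift A)) & set0].
  by apply/disj_setPS => x [].
rewrite setU0 => /eqP.
by rewrite -subr_eq0 opprD addrA subrr sub0r oppr_eq0 => /eqP.
Qed.

Let p_bigsetU (F : nat -> set (full_shift A)) n : trivIset setT F ->
  p (\big[setU/set0]_(i < n) F i) = \sum_(i < n) p (F i).
Proof.
move=> tF; elim: n => [|n ih]; first by rewrite !big_ord0.
rewrite !big_ord_recr/= pU ?ih//; apply/disj_setPS => x [].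
rewrite -bigcup_mkord => -[i /= ni Fi] Fn.
have : i = n by apply: tF => //; exists x.
by move=> ni'; rewrite ni' ltnn in ni.
Qed.

(* By compactness a clopen set is never a genuinely infinite disjoint union of
   clopen sets, so finite additivity suffices. *)
Let finitely_many_clopen (F : nat -> set (clopen_space A)) :
  (forall i, measurable (F i)) -> trivIset setT F ->
  measurable (\bigcup_i F i) ->
  exists N, forall i, (N <= i)%N -> F i = set0.
Proof.
move=> mF tF [n nF].
pose f i : set (full_shift A) := ~` (\bigcup_i F i) `|` F i.
have := @full_shift_compact A; rewrite compact_cover.
move=> /(_ nat setT f) [i _|x _|E _ Ef].
- have [k kF] := mF i; apply: (@depends_on_open _ (maxn n k)) => x y xy.
  congr (~ _ \/ _); first exact/nF/(agree_le (leq_maxl _ _) xy).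
  exact/kF/(agree_le (leq_maxr _ _) xy).
- have [[i _ Fi]|nFx] := pselect ((\bigcup_i F i) x).
    by exists i => //; right.
  by exists 0%N => //; left.
exists (\max_(i <- finmap.enum_fset E) i).+1 => i iE; rewrite -subset0 => x Fix.
have [j /= jE [[]|Fjx]] := Ef x I; first by exists i.
have ij : i = j by apply: tF => //; exists x.
by move: iE; rewrite ij ltnNge => /negP; apply; exact: leq_bigmax_seq.
Qed.

Let m_sigma_additive : semi_sigma_additive m.
Proof.
move=> F mF tF mUF; have [N FN] := finitely_many_clopen mF tF mUF.
apply: cvg_near_cst; exists N => // n /= Nn.
rewrite big_mkord sumEFin -p_bigsetU// /m/=; congr (p _)%:E.
rewrite -bigcup_mkord eqEsubset; split=> [x [i _ ?]|x [i _ Fi]]; exists i => //=.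
by apply: contraPT Fi; rewrite -leqNgt => ni; rewrite FN// (leq_trans Nn).
Qed.

HB.instance Definition _ := isMeasure.Build _ _ _ m
  (congr1 EFin p0) (fun C => p_ge0 C : (0 <= m C)%E) m_sigma_additive.

(** The Caratheodory extension lives on the sigma-algebra generated by the clopen sets, which
    [measurable_full_shiftE] identifies with the Borel one. *)
Let mu : set (full_shift A) -> \bar R := measure_extension m.

Let mu_sigma_additive : semi_sigma_additive mu.
Proof.
move=> F mF tF mUF; apply: measure_semi_sigma_additive => // [i|].
  by have := mF i; rewrite measurable_full_shiftE.
by move: mUF; rewrite measurable_full_shiftE.
Qed.

HB.instance Definition _ := isMeasure.Build _ _ _ mu
  (measure0 (measure_extension m)) (measure_ge0 (measure_extension m))
  mu_sigma_additive.

Let muE n C : depends_on n C -> mu C = (p C)%:E.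
Proof.
by move=> nC; rewrite /mu /measure_extension measurable_mu_extE//; exists n.
Qed.

HB.instance Definition _ := Measure_isProbability.Build _ _ _ mu
  (etrans (@muE 0 setT (fun _ _ _ => erefl)) (congr1 EFin pT)).

Lemma charge_extension : exists nu : probability (full_shift A) R,
  forall n C, depends_on n C -> nu C = (p C)%:E.
Proof. by exists mu. Qed.

End charge_extension.

(** * Approximation of measurable partitions by clopen ones *)

Section approximation.
Context (R : realType) (A : pfinType) (nu : probability (full_shift A) R).
Implicit Types B C : set (full_shift A).

Let sd B C := (B `\` C) `|` (C `\` B).

Let approximable B := forall d : R, 0 < d ->
  exists n C, depends_on n C /\ (nu (sd B C) <= d%:E)%E.

Let measurable_sd n B C : measurable B -> depends_on n C -> measurable (sd B C).
Proof.
move=> mB /depends_on_measurable mC.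
by apply: measurableU; exact: measurableD.
Qed.

Let approximableU B B' : measurable B -> measurable B' ->
  approximable B -> approximable B' -> approximable (B `|` B').
Proof.
move=> mB mB' aB aB' d d0; have d20 : 0 < d / 2 by rewrite divr_gt0.
have [n [C [nC BC]]] := aB _ d20; have [n' [C' [nC' BC']]] := aB' _ d20.
exists (maxn n n'), (C `|` C'); split.
  move=> x y xy; congr (_ \/ _); first exact/nC/(agree_le (leq_maxl _ _) xy).
  exact/nC'/(agree_le (leq_maxr _ _) xy).
have mBC := measurable_sd mB nC; have mBC' := measurable_sd mB' nC'.
rewrite (splitr d) EFinD; apply: le_trans (leeD BC BC').
apply: le_trans (measureU2 nu mBC mBC'); apply: le_measure; rewrite ?inE//.
- have mC := depends_on_measurable nC; have mC' := depends_on_measurable nC'.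
  by apply: measurableU; apply: measurableD; exact: measurableU.
- exact: measurableU.
- move=> x; rewrite /sd /setU /setD /=; tauto.
Qed.

(** The approximable measurable sets form a sigma-algebra that contains the clopen sets. A countable
    union is first cut off to a finite one, then that one is approximated, with [d / 2] for each. *)
Let measurable_approximable B : measurable B -> approximable B.
Proof.
pose S := [set B | measurable B /\ approximable B].
suff : @measurable _ (full_shift A) `<=` S by move=> h /h[].
rewrite measurable_full_shiftE; apply: smallest_sub; last first.
  move=> C [n nC]; split; first exact: depends_on_measurable nC.
  move=> d d0; exists n, C; split=> //.
  by rewrite /sd setDv setU0 measure0 lee_fin ltW.
split.
- split=> // d d0; exists 0%N, set0; split=> //.
  by rewrite /sd setDv setU0 measure0 lee_fin ltW.
- move=> B' [mB' aB']; rewrite setTD; split; first exact: measurableC.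
  move=> d /aB' [n [C [nC BC]]]; exists n, (~` C); split.
    by move=> x y xy; congr (~ _); exact: nC.
  rewrite /sd !setDE !setCK setUC; congr (nu _ <= _)%E : BC.
  by rewrite /sd !setDE (setIC C) (setIC B').
move=> F FS; have mF i := (FS i).1.
pose G n := \big[setU/set0]_(i < n) F i; pose U := \bigcup_i F i.
have mG n : measurable (G n) by exact: bigsetU_measurable.
have mU : measurable U by exact: bigcupT_measurable.
split=> // d d0; have d20 : 0 < d / 2 by rewrite divr_gt0.
have aG n : approximable (G n).
  rewrite /G; elim: n => [|n ih].
    move=> e e0; exists 0%N, set0; rewrite big_ord0; split=> //.
    by rewrite /sd setDv setU0 measure0 lee_fin ltW.
  rewrite big_ord_recr/=; apply: approximableU => //; [exact: mG|exact: (FS n).2].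
(* The remainders decrease to the empty set, so continuity from above applies. *)
have [l Ul] : exists l, (nu (U `\` G l) <= (d / 2)%:E)%E.
  have : nu \o (fun n => U `\` G n) @ \oo --> nu (\bigcap_n (U `\` G n)).
    apply: nonincreasing_cvg_mu.
    - by rewrite (le_lt_trans (probability_le1 _ _)) ?ltry//; exact: measurableD.
    - by move=> i; exact: measurableD.
    - by apply: bigcap_measurable => // i _; exact: measurableD.
    - move=> i j ij; apply/subsetPset; apply: setDS.
      rewrite /G -!bigcup_mkord => x [k /= ki Fx].
      by exists k => //=; exact: leq_trans ij.
  rewrite (_ : \bigcap_n _ = set0); last first.
    rewrite -subset0 => x h; have [[i _ Fx] _] := h 0%N I.
    have [_] := h i.+1 I; apply; rewrite /G -bigcup_mkord.
    by exists i => //=.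
  rewrite measure0 => /fine_cvgP[_ /cvgrPdist_lt /(_ _ d20)[l _ /(_ l (leqnn _))]].
  rewrite /= sub0r normrN => nd; exists l.
  rewrite -[leLHS]fineK ?lee_fin; first exact: le_trans (ler_norm _) (ltW nd).
  by apply: fin_num_measure; exact: measurableD.
have [m [C [mC GC]]] := aG l _ d20.
exists m, C; split=> //.
have mGC := measurable_sd (mG l) mC.
have mUG : measurable (U `\` G l) by exact: measurableD.
rewrite (splitr d) EFinD; apply: le_trans (leeD Ul GC).
apply: le_trans (measureU2 nu mUG mGC); apply: le_measure; rewrite ?inE//.
- exact: measurable_sd mU mC.
- exact: measurableU.
- have GU : G l `<=` U by rewrite /G -bigcup_mkord => y [i _ Fy]; exists i.
  move=> x; have := GU x; have := pselect (G l x); rewrite /sd /setU /setD /=; tauto.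
Qed.

Let measure_bigsetU_le (I : Type) (r : seq I) (D : I -> set (full_shift A)) :
  (forall i, measurable (D i)) ->
  (nu (\big[setU/set0]_(i <- r) D i) <= \sum_(i <- r) nu (D i))%E.
Proof.
move=> mD; elim: r => [|i r ih]; first by rewrite !big_nil measure0.
rewrite !big_cons; apply: le_trans (leeD (lexx _) ih).
apply: measureU2 => //; exact: bigsetU_measurable.
Qed.

(** Each atom is replaced by a clopen approximation, and [f] reads the label off these. It can be
    wrong only where some atom differs from its approximation. *)
Lemma partition_approximation k (P : 'I_k -> set (full_shift A)) (d : R) :
  (forall i, measurable (P i)) -> partition [set: 'I_k] P setT -> 0 < d ->
  exists N (f : full_shift A -> 'I_k), depends_on N f /\
    measurable [set x | ~ P (f x) x] /\ (nu [set x | ~ P (f x) x] <= d%:E)%E.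
Proof.
move=> mP [PT tP _] d0.
(* Dividing by [k.+1] keeps the divisor visibly positive and still lets [k] errors add up to at most
   [d]. *)
have dk0 : 0 < d / k.+1%:R by rewrite divr_gt0.
have /choice[nC nCP] i : exists nC : nat * set (full_shift A),
    depends_on nC.1 nC.2 /\ (nu (sd (P i) nC.2) <= (d / k.+1%:R)%:E)%E.
  by have [n [C ?]] := measurable_approximable (mP i) dk0; exists (n, C).
pose N := \max_(i < k) (nC i).1; pose C i := (nC i).2.
have NC i : depends_on N (C i).
  apply: depends_on_le (nCP i).1; exact: leq_bigmax.
have [i0 _ _] : cover setT P point by rewrite PT.
pose f x := odflt i0 [pick i | `[< C i x >]].
have Nf : depends_on N f.
  move=> x y xy; rewrite /f; congr odflt; apply: eq_pick => i.
  by rewrite (NC i x y xy).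
exists N, f; split=> //.
pose bad := \big[setU/set0]_(i < k) sd (P i) (C i).
have mbad i : measurable (sd (P i) (C i)) by exact: measurable_sd (NC i).
have fbad : [set x | ~ P (f x) x] `<=` bad.
  move=> x /= Pfx; apply: contrapT => nbad; apply: Pfx.
  have PC i : P i x <-> C i x.
    have sdbad : sd (P i) (C i) x -> bad x.
      by rewrite /bad -bigcup_seq => ?; exists i => //=; rewrite mem_index_enum.
    by split=> h; apply: contrapT => nh; apply/nbad/sdbad; [left|right].
  have [i _ Pix] : cover setT P x by rewrite PT.
  rewrite /f; case: pickP => [j /asboolP/PC//|/(_ i)].
  by move/asboolP => []; exact/PC.
have mPf : measurable [set x | ~ P (f x) x].
  rewrite (_ : [set x | _] =
      ~` \big[setU/set0]_(i <- index_enum 'I_k) (P i `&` f @^-1` [set i])).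
    apply/measurableC/bigsetU_measurable => i _; apply: measurableI => //.
    by apply: (@depends_on_measurable _ N) => x y xy; rewrite /preimage/= (Nf x y).
  rewrite -bigcup_seq eqEsubset; split=> x /=.
    by move=> Pfx [i _ [Pix fxi]]; apply: Pfx; rewrite fxi.
  by apply: contra_not => Pfx; exists (f x) => //=; rewrite mem_index_enum.
split=> //; apply: (@le_trans _ _ (nu bad)).
  by apply: le_measure; rewrite ?inE//; exact: bigsetU_measurable.
apply: le_trans (measure_bigsetU_le _ mbad) _.
apply: (@le_trans _ _ (\sum_(i < k) (d / k.+1%:R)%:E)%E).
  by apply: lee_sum => i _; exact: (nCP i).2.
rewrite sumEFin lee_fin sumr_const card_ord -[leLHS]mulr_natr mulrAC.
by rewrite ler_pdivrMr// ler_pM2l// ler_nat.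
Qed.

End approximation.

(** * Integration of bounded measurable functions, and shift invariance *)

Section bounded_integrals.
Context (R : realType) (A : pfinType) (nu : probability (full_shift A) R).
Implicit Types f g h : full_shift A -> R.
Notation T := (@shift_map A).

Definition bounded_measurable f :=
  measurable_fun setT f /\ exists c, forall x, `|f x| <= c.

Lemma bounded_measurable_integrable f :
  bounded_measurable f -> nu.-integrable setT (EFin \o f).
Proof.
move=> [mf [c fc]]; apply: measurable_bounded_integrable => //.
  by rewrite (le_lt_trans (probability_le1 _ _)) ?ltry.
exists c; split; first exact: num_real.
by move=> M cM x _; rewrite /= (le_trans (fc x))// ltW.
Qed.

Lemma bounded_measurable_cst c : bounded_measurable (cst c).
Proof. by split; [exact: measurable_cst|exists `|c|]. Qed.

Lemma bounded_measurableD f g : bounded_measurable f ->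
  bounded_measurable g -> bounded_measurable (fun x => f x + g x).
Proof.
move=> [mf [c fc]] [mg [c' gc]]; split; first exact: measurable_funD.
by exists (c + c') => x; rewrite (le_trans (ler_normD _ _))// lerD.
Qed.

Lemma bounded_measurableZ c f : bounded_measurable f ->
  bounded_measurable (fun x => c * f x).
Proof.
move=> [mf [c' fc]]; split; first exact: measurable_funM.
by exists (`|c| * c') => x; rewrite normrM ler_wpM2l.
Qed.

Lemma bounded_measurable_sum (I : Type) (r : seq I) (f : I -> full_shift A -> R) :
  (forall i, bounded_measurable (f i)) ->
  bounded_measurable (fun x => \sum_(i <- r) f i x).
Proof.
move=> bf; elim: r => [|i r ih].
  by under eq_fun do rewrite big_nil; exact: bounded_measurable_cst.
by under eq_fun do rewrite big_cons; exact: bounded_measurableD.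
Qed.

Lemma bounded_measurable_indic C : measurable C ->
  bounded_measurable (\1_C : _ -> R).
Proof.
move=> mC; split; first exact: measurable_indic.
by exists 1 => x; rewrite indicE; case: (_ \in _); rewrite ?normr1 ?normr0.
Qed.

Lemma bounded_measurable_iter_shift n f : bounded_measurable f ->
  bounded_measurable (f \o iter n T).
Proof.
move=> [mf [c fc]]; elim: n => [|n [mg _]]; first by split; [|exists c].
split; last by exists c => x; exact: fc.
rewrite (_ : _ \o _ = (f \o iter n T) \o T); last first.
  by apply/funext => x; rewrite /= -iterSr.
exact: measurableT_comp mg (@measurable_shift A).
Qed.

Local Notation E f := (\int[nu]_x f x).

Lemma bounded_RintegralD f g : bounded_measurable f -> bounded_measurable g ->
  E (fun x => f x + g x) = E f + E g.
Proof.
by move=> bf bg; apply: RintegralD => //;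
  exact: bounded_measurable_integrable.
Qed.

Lemma bounded_RintegralZ c f : bounded_measurable f ->
  E (fun x => c * f x) = c * E f.
Proof.
by move=> bf; apply: RintegralZl => //;
  exact: bounded_measurable_integrable.
Qed.

Lemma Rintegral_probability_cst c : E (cst c) = c.
Proof. by rewrite Rintegral_cst//= [X in fine X]probability_setT mulr1. Qed.

Lemma le_bounded_Rintegral f g : bounded_measurable f -> bounded_measurable g ->
  (forall x, f x <= g x) -> E f <= E g.
Proof.
by move=> bf bg fg; apply: le_Rintegral => //; exact: bounded_measurable_integrable.
Qed.

Lemma bounded_Rintegral_sum (I : Type) (r : seq I) (f : I -> full_shift A -> R) :
  (forall i, bounded_measurable (f i)) ->
  E (fun x => \sum_(i <- r) f i x) = \sum_(i <- r) E (f i).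
Proof.
move=> bf; elim: r => [|i r ih].
  under eq_Rintegral do rewrite big_nil.
  by rewrite big_nil Rintegral_probability_cst.
under eq_Rintegral do rewrite big_cons.
by rewrite big_cons bounded_RintegralD// ?ih//; exact: bounded_measurable_sum.
Qed.

Lemma Rintegral_indic C : measurable C -> E (\1_C) = fine (nu C).
Proof. by move=> mC; rewrite /Rintegral integral_indic// setIT. Qed.

Lemma Rintegral_label (I : finType) (lab : full_shift A -> I) (G : I -> R) :
  (forall i, measurable (lab @^-1` [set i])) ->
  bounded_measurable (fun z => G (lab z)) /\
  E (fun z => G (lab z)) = \sum_i G i * fine (nu (lab @^-1` [set i])).
Proof.
move=> mlab.
have GE : (fun z => G (lab z)) =
    fun z => \sum_i G i * \1_(lab @^-1` [set i]) z :> R.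
  apply/funext => z; rewrite (bigD1 (lab z))//= big1 ?addr0.
    by rewrite indicE mem_set// mulr1.
  by move=> i /eqP izl; rewrite indicE memNset ?mulr0// => /esym.
have bi i : bounded_measurable (fun z => G i * \1_(lab @^-1` [set i]) z).
  exact/bounded_measurableZ/bounded_measurable_indic.
split; first by rewrite GE; exact: bounded_measurable_sum.
rewrite GE bounded_Rintegral_sum//; apply: eq_bigr => i _.
by rewrite bounded_RintegralZ ?Rintegral_indic//; exact: bounded_measurable_indic.
Qed.

Hypothesis invnu : invariant_measure T nu.

Lemma Rintegral_shift f : bounded_measurable f -> E (f \o T) = E f.
Proof.
move=> bf; rewrite /Rintegral; congr fine.
have /integrableP[mf _] := bounded_measurable_integrable bf.
have bfT : nu.-integrable (T @^-1` setT) ((EFin \o f) \o T).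
  rewrite preimage_setT.
  exact/bounded_measurable_integrable/(bounded_measurable_iter_shift 1).
have := integral_pushforward (@measurable_shift A) mf bfT measurableT.
rewrite preimage_setT => <-; apply: eq_measure_integral.
  exact: measurable_shift.
by move=> mT B mB _; exact: invnu.
Qed.

Lemma Rintegral_iter_shift n f : bounded_measurable f -> E (f \o iter n T) = E f.
Proof.
move=> bf; elim: n => // n ih.
rewrite -[RHS]ih -(Rintegral_shift (bounded_measurable_iter_shift n bf)).
by apply: eq_Rintegral => x _; rewrite /= -iterSr.
Qed.

End bounded_integrals.

(** Where [p i] is positive, [ln (q i / p i) <= q i / p i - 1] is multiplied by [p i]; where it
    vanishes, only [- q i <= 0] is left to check. The sum of the [p i - q i] is nonnegative by
    hypothesis. *)
Lemma gibbs_inequality (R : realType) (I : finType) (p q : I -> R) :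
  (forall i, 0 <= p i) -> (forall i, 0 < q i) -> \sum_i q i <= \sum_i p i ->
  - \sum_i p i * ln (p i) <= \sum_i - ln (q i) * p i.
Proof.
move=> p0 q0 qp; rewrite -subr_ge0 opprK -big_split/=.
apply: (@le_trans _ _ (\sum_i (p i - q i))).
  by rewrite sumrB subr_ge0.
apply: ler_sum => i _; have := p0 i; rewrite le_eqVlt => /predU1P[<-|pi0].
  by rewrite mulr0 mul0r sub0r addr0 oppr_le0 ltW.
have : ln (1 + (q i / p i - 1)) <= q i / p i - 1.
  by apply: le_ln1Dx; rewrite ltrBrDr addrC subrr divr_gt0.
rewrite [1 + _]addrC subrK ln_div ?posrE// => h.
have := ler_wpM2l (ltW pi0) h.
by rewrite mulrBr mulrBr mulr1 mulrCA divff ?gt_eqF// mulr1 => ?; lra.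
Qed.

(** * Itineraries and the atoms of iterated joins *)

Section labelled_partition.
Context (R : realType) (A : pfinType) (nu : probability (full_shift A) R).
Notation T := (@shift_map A).
Context k (Q : 'I_k -> set (full_shift A)).
Hypothesis mQ : forall i, measurable (Q i).
Hypothesis partQ : partition [set: 'I_k] Q setT.

Lemma measurable_iter_shift n B : measurable B -> measurable (iter n T @^-1` B).
Proof.
move=> mB; elim: n => // n ih.
rewrite (_ : _ @^-1` _ = setT `&` T @^-1` (iter n T @^-1` B)).
  exact: measurable_shift.
by rewrite setTI; apply/funext => x; rewrite /preimage/= -iterSr.
Qed.

Lemma partition_label : exists lab : full_shift A -> 'I_k,
  forall i x, Q i x <-> lab x = i.
Proof.
have [QT tQ _] := partQ.
have /choice[lab labQ] x : exists i, Q i x.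
  have [i _ Qx] : cover setT Q x by rewrite QT.
  by exists i.
exists lab => i x; split=> [Qix|<-//].
by apply: tQ => //; exists x.
Qed.

Variable lab : full_shift A -> 'I_k.
Hypothesis labQ : forall i x, Q i x <-> lab x = i.

Definition itinerary n z : {ffun 'I_n -> 'I_k} :=
  [ffun i : 'I_n => lab (iter i T z)].

Lemma join_iterE n (w : {ffun 'I_n -> 'I_k}) :
  join_iter T Q w = @itinerary n @^-1` [set w].
Proof.
rewrite /join_iter eqEsubset; split=> x /=.
  by move=> Qx; apply/ffunP => i; rewrite ffunE; exact: (labQ _ _).1 (Qx i I).
by move=> xw i _; apply: (labQ _ _).2; rewrite -xw ffunE.
Qed.

Lemma measurable_join_iter n (w : {ffun 'I_n -> 'I_k}) :
  measurable (join_iter T Q w).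
Proof.
apply: fin_bigcap_measurable; first exact: finite_finset.
by move=> i _; exact: measurable_iter_shift.
Qed.

(** Turns sums over the atoms of a join into integrals over points, where invariance can be used. *)
Lemma Rintegral_itinerary n (G : {ffun 'I_n -> 'I_k} -> R) :
  bounded_measurable (fun z => G (itinerary n z)) /\
  \int[nu]_z G (itinerary n z) = \sum_w G w * fine (nu (join_iter T Q w)).
Proof.
have mit (w : {ffun 'I_n -> 'I_k}) : measurable (@itinerary n @^-1` [set w]).
  by rewrite -join_iterE; exact: measurable_join_iter.
have [? ->] := Rintegral_label nu G mit; split=> //.
by apply: eq_bigr => w _; rewrite join_iterE.
Qed.

Lemma join_iter_sum1 n :
  \sum_(w : {ffun 'I_n -> 'I_k}) fine (nu (join_iter T Q w)) = 1.
Proof.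
have [_] := @Rintegral_itinerary n (cst 1).
rewrite (Rintegral_probability_cst nu 1) => ->.
by apply: eq_bigr => w _; rewrite mul1r.
Qed.

Lemma join_iter_ge0 n (w : {ffun 'I_n -> 'I_k}) :
  0 <= fine (nu (join_iter T Q w)).
Proof. exact: fine_ge0. Qed.

Lemma shannon_entropy_ge0 n : 0 <= shannon_entropy nu (@join_iter _ _ T _ Q n).
Proof.
rewrite /shannon_entropy oppr_ge0 sumr_le0// => w _.
rewrite mulr_ge0_le0 ?fine_ge0// ln_le0//.
rewrite -(join_iter_sum1 n) (bigD1 w)//= lerDl sumr_ge0// => v _.
exact: join_iter_ge0.
Qed.

End labelled_partition.

(** * Upper bound for the entropy of any invariant measure *)

Section variational_upper_bound.
Context (R : realType) (A : pfinType) (phi : full_shift A -> R) (V : R).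
Hypothesis distortion :
  forall n x y, agree n x y -> birkhoff phi n x <= birkhoff phi n y + V.
Hypothesis bphi : bounded_measurable phi.
Variable x0 : full_shift A.
Notation T := (@shift_map A).
Notation Z n := (transfer phi n (cst 1) x0).
Variable P : R.
Hypothesis rate : forall n, `|ln (Z n) - n%:R * P| <= 2 * V.
Variable nu : probability (full_shift A) R.
Hypothesis invnu : invariant_measure T nu.
Notation E f := (\int[nu]_x f x).

Lemma bounded_measurable_birkhoff n : bounded_measurable (birkhoff phi n).
Proof.
by apply: bounded_measurable_sum => i; exact: (bounded_measurable_iter_shift i bphi).
Qed.

Lemma Rintegral_birkhoff n : E (birkhoff phi n) = n%:R * E phi.
Proof.
rewrite bounded_Rintegral_sum; last first.
  by move=> i; exact: (bounded_measurable_iter_shift i bphi).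
rewrite (eq_bigr (fun=> E phi)) => [|i _].
  by rewrite sumr_const card_ord mulr_natl.
exact: (Rintegral_iter_shift invnu i bphi).
Qed.

(** The Gibbs inequality is tested against [q w], the normalized transfer of a product [F w] of
    reading weights. As [Q] is only measurable, labels are read through a clopen approximation [f],
    which makes [F w] depend on [n + N] coordinates and distortion apply. *)
Lemma join_entropy_le k (Q : 'I_k -> set (full_shift A)) (e : R) :
  (forall i, measurable (Q i)) -> partition [set: 'I_k] Q setT -> 0 < e ->
  exists K, forall n, shannon_entropy nu (@join_iter _ _ T _ Q n)
    <= n%:R * (P - E phi + e) + K.
Proof.
move=> mQ partQ e0; have [lab labQ] := partition_label partQ.
have k0 : 0 < k%:R :> R.
  by rewrite ltr0n; apply: leq_ltn_trans (ltn_ord (lab point)).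
(* A correct reading costs at most [e / 2]; the leftover mass [1 - t] is shared equally among the
   [k] labels. *)
pose t : R := expR (- (e / 2)).
have t1 : t < 1 by rewrite expR_lt1 oppr_lt0 divr_gt0.
have t0 : 0 < t by exact: expR_gt0.
pose s : R := (1 - t) / k%:R.
have s0 : 0 < s by rewrite divr_gt0// subr_gt0.
have s1 : s <= 1.
  rewrite ler_pdivrMr// mul1r (@le_trans _ _ 1)//; first by lra.
  by rewrite ler1n -(ltr0n R).
(* [r i j] weighs the label [i] when the approximation [f] below reads [j]:
   it stays positive on misreadings and is almost 1 on the diagonal. *)
pose r (i j : 'I_k) : R := t * (i == j)%:R + s.
have r0 i j : 0 < r i j by rewrite ltr_wpDl// mulr_ge0// ltW.
have r_sum j : \sum_i r i j = 1.
  rewrite big_split/= (bigD1 j)//= big1 => [|i /negPf->]; last by rewrite mulr0.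
  rewrite eqxx mulr1 addr0 sumr_const card_ord -mulr_natr /s divfK ?gt_eqF//.
  by rewrite addrC subrK.
pose b := - ln s.
have b0 : 0 <= b by rewrite oppr_ge0 ln_le0.
(* A misreading costs an extra [b] at most, so at this frequency the mean extra cost per letter is
   at most [e / 2]; the [+ 1] covers [b = 0]. *)
have d0 : 0 < e / 2 / (b + 1) by rewrite !divr_gt0// ltr_wpDl.
have [N [f [Nf [mbad bad_le]]]] := partition_approximation nu mQ partQ d0.
set bad := [set x | _] in mbad bad_le.
have r_ge z : expR (- (e / 2 + b * \1_bad z)) <= r (lab z) (f z).
  rewrite indicE; have [Qz|badz] := pselect (Q (f z) z).
    rewrite memNset// mulr0 addr0 /r -((labQ _ _).1 Qz) eqxx mulr1.
    by rewrite lerDl ltW.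
  rewrite mem_set// mulr1; apply: (@le_trans _ _ s).
    by rewrite -[leRHS]lnK ?posrE// ler_expR /b; lra.
  by rewrite lerDr mulr_ge0// ltW.
(* [V] comes from the lower bound on the transfer and [2 * V] from [rate]; the last term accounts
   for the [N] extra coordinates that [f] reads. *)
exists (3 * V + N%:R * (P - E phi)) => n.
pose F (w : {ffun 'I_n -> 'I_k}) z := \prod_(i < n) r (w i) (f (iter i T z)).
have F0 w z : 0 <= F w z by apply: prodr_ge0 => i _; exact: ltW.
have nF w : depends_on (n + N) (F w).
  move=> x y xy; apply: eq_bigr => i _; congr (r _ _).
  apply: (depends_on_comp_shift (m := i) Nf).
  by apply: agree_le xy; rewrite leq_add2r ltnW.
have Z0 m : 0 < Z m by exact: transfer1_gt0 distortion _ _.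
pose q w := transfer phi (n + N) (F w) x0 / Z (n + N).
have q_ge z : expR (birkhoff phi (n + N) z - V
    - \sum_(i < n) (e / 2 + b * \1_bad (iter i T z))) / Z (n + N)
    <= q (itinerary lab n z).
  rewrite ler_pM2r ?invr_gt0//.
  apply: le_trans (transfer_cylinder_ge distortion x0 z (F0 _) (nF _)).
  rewrite expRD ler_pM2l ?expR_gt0// -sumrN expR_sum; apply: ler_prod => i _.
  by rewrite expR_ge0/= ffunE r_ge.
have q0 w : 0 < q w.
  rewrite divr_gt0//.
  apply: lt_le_trans _ (transfer_cylinder_ge distortion x0 x0 (F0 w) (nF w)).
  by rewrite mulr_gt0 ?expR_gt0// prodr_gt0.
(* At each time the weights [r] sum to 1 over the label, so by distributivity the products [F w z]
   sum to 1 over [w]. *)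
have q_sum : \sum_w q w = 1.
  rewrite -mulr_suml -transfer_sum (_ : (fun z => _) = cst 1) ?divff ?gt_eqF//.
  apply/funext => z; rewrite /F.
  rewrite -(bigA_distr_bigA (fun (i : 'I_n) j => r j (f (iter i T z)))) big1//.
have [bq Eq] := Rintegral_itinerary nu mQ labQ
  (fun w : {ffun 'I_n -> 'I_k} => - ln (q w)).
(* A pointwise bound for [- ln (q w)] along the itinerary of [z], whose integral invariance makes
   explicit. *)
pose Psi z := (V + ln (Z (n + N)) + n%:R * (e / 2)) +
  (- 1 * birkhoff phi (n + N) z + b * \sum_(i < n) \1_bad (iter i T z)).
have bbad := @bounded_measurable_indic R A _ mbad.
have bsum : bounded_measurable (fun z => \sum_(i < n) \1_bad (iter i T z) : R).
  by apply: bounded_measurable_sum => i; exact: bounded_measurable_iter_shift.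
have bS := bounded_measurable_birkhoff (n + N).
have bPsi2 := bounded_measurableD (bounded_measurableZ (- 1) bS)
  (bounded_measurableZ b bsum).
have bPsi : bounded_measurable Psi.
  exact: bounded_measurableD (bounded_measurable_cst _ _) bPsi2.
have qPsi z : - ln (q (itinerary lab n z)) <= Psi z.
  have := q_ge z; rewrite -ler_ln ?posrE ?q0 ?divr_gt0 ?expR_gt0//.
  rewrite ln_div ?posrE ?expR_gt0// expRK big_split/= sumr_const.
  by rewrite card_ord -mulr_natl -mulr_sumr /Psi; lra.
have EPsi : E Psi = V + ln (Z (n + N)) + n%:R * (e / 2) +
    (- ((n + N)%:R * E phi) + b * (n%:R * fine (nu bad))).
  rewrite /Psi bounded_RintegralD//; last exact: bounded_measurable_cst.
  rewrite Rintegral_probability_cst bounded_RintegralD;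
    [|exact: bounded_measurableZ..].
  rewrite !bounded_RintegralZ// Rintegral_birkhoff bounded_Rintegral_sum => [|i];
    last exact: bounded_measurable_iter_shift.
  rewrite mulN1r (eq_bigr (fun=> fine (nu bad))) => [|i _].
    by rewrite sumr_const card_ord -[fine _ *+ n]mulr_natl.
  by rewrite (Rintegral_iter_shift invnu i bbad) Rintegral_indic.
have bd : b * fine (nu bad) <= e / 2.
  have : fine (nu bad) <= e / 2 / (b + 1).
    by rewrite -lee_fin fineK// fin_num_measure.
  rewrite ler_pdivlMr ?ltr_wpDl// => h.
  have : 0 <= fine (nu bad) by exact: fine_ge0.
  by lra.
have : shannon_entropy nu (@join_iter _ _ T _ Q n) <= E Psi.
  apply: le_trans (le_bounded_Rintegral nu bq bPsi qPsi).
  rewrite Eq /shannon_entropy.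
  apply: gibbs_inequality => [w|w|]; [exact: fine_ge0|exact: q0|].
  by rewrite q_sum (join_iter_sum1 nu mQ labQ).
move/le_trans; apply; rewrite EPsi.
have : n%:R * (b * fine (nu bad)) <= n%:R * (e / 2) by rewrite ler_wpM2l.
have := rate (n + N); rewrite ler_norml natrD => /andP[_].
by lra.
Qed.

End variational_upper_bound.

(** * Limits of averages with bounded error *)

Section average_limits.
Context (R : realType).
Implicit Types (H : nat -> R) (B C K : R).

Lemma cvg_natV : (n%:R^-1 : R) @[n --> \oo] --> (0 : R).
Proof. by rewrite -cvg_shiftS; exact: cvg_harmonic. Qed.

(* [limn] of a divergent sequence is the default value 0, hence the need for
   [0 <= H n]. *)
Lemma lim_average_le H B : (forall n, 0 <= H n) ->
  (forall e, 0 < e -> exists K, forall n, H n <= n%:R * (B + e) + K) ->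
  limn (fun n => n%:R^-1 * H n) <= B.
Proof.
move=> H0 HB; apply/ler_addgt0Pr => e e0; have [K HK] := HB _ e0.
pose w n : R := B + e + K * n%:R^-1.
have cw : w @ \oo --> B + e.
  rewrite -[X in _ --> X]addr0; apply: cvgD; first exact: cvg_cst.
  by rewrite -[X in _ --> X](mulr0 K); apply: cvgMr; exact: cvg_natV.
have uw : \forall n \near \oo, n%:R^-1 * H n <= w n.
  exists 1%N => // n /= n1; have n0 : 0 < n%:R :> R by rewrite ltr0n.
  by rewrite ler_pdivrMl// mulrDr mulrCA divff ?gt_eqF// mulr1.
have [cu|/dvgP ->] := pselect (cvgn (fun n => n%:R^-1 * H n)).
  by apply: (ler_cvg_to cu cw).
apply: (cvgr_to_ge cw); apply: filterS uw => n; apply: le_trans.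
by rewrite mulr_ge0// invr_ge0.
Qed.

Lemma cvg_average H B K : (forall n, `|H n - n%:R * B| <= K) ->
  (n%:R^-1 * H n) @[n --> \oo] --> B.
Proof.
move=> HB; apply: (@squeeze_cvgr _ _ _ _ (fun n => B - K * n%:R^-1)
    (fun n => B + K * n%:R^-1)).
- exists 1%N => // n /= n1; have n0 : 0 < n%:R :> R by rewrite ltr0n.
  have -> : n%:R^-1 * H n = B + n%:R^-1 * (H n - n%:R * B).
    by rewrite mulrBr mulKf ?gt_eqF// addrC subrK.
  have := HB n; rewrite ler_norml => /andP[h1 h2].
  by rewrite !lerD2l -mulNr ![_ * n%:R^-1]mulrC !ler_pM2l ?invr_gt0// h1.
- rewrite -[X in _ --> X]subr0; apply: cvgB; first exact: cvg_cst.
  by rewrite -[X in _ --> X](mulr0 K); apply: cvgMr; exact: cvg_natV.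
- rewrite -[X in _ --> X]addr0; apply: cvgD; first exact: cvg_cst.
  by rewrite -[X in _ --> X](mulr0 K); apply: cvgMr; exact: cvg_natV.
Qed.

End average_limits.

(** * Gibbs measures: entropy, equilibrium and existence *)

Section gibbs_measures.
Context (R : realType) (A : pfinType) (phi : full_shift A -> R) (V : R).
Hypothesis distortion :
  forall n x y, agree n x y -> birkhoff phi n x <= birkhoff phi n y + V.
Hypothesis bphi : bounded_measurable phi.
Variable x0 : full_shift A.
Notation T := (@shift_map A).
Notation Z n := (transfer phi n (cst 1) x0).
Variable P : R.
Hypothesis rate : forall n, `|ln (Z n) - n%:R * P| <= 2 * V.
Implicit Types nu : probability (full_shift A) R.

(** The Gibbs property in ratio form, for all sets of [n] coordinates at once; [gibbs_cylinder] and
    [rate] give back the usual estimate on cylinders. *)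
Definition gibbs_measure nu := forall n C, depends_on n C ->
  fine (nu C) <= expR V ^+ 4 * (transfer phi n \1_C x0 / Z n) /\
  transfer phi n \1_C x0 / Z n <= expR V ^+ 4 * fine (nu C).

Lemma ks_entropy_le nu : invariant_measure T nu ->
  (ks_entropy T nu <= (P - \int[nu]_x phi x)%:E)%E.
Proof.
move=> invnu; apply: ge_ereal_sup => _ [k [Q [mQ partQ ->]]].
have [lab labQ] := partition_label partQ.
rewrite lee_fin; apply: lim_average_le => [n|e e0].
  exact: (shannon_entropy_ge0 nu mQ labQ).
exact: (join_entropy_le distortion bphi rate invnu).
Qed.

Lemma transfer_agree_le n z :
  transfer phi n \1_(agree n z) x0 <= expR (birkhoff phi n z + V).
Proof.
(* Exactly one preimage of [x] under [iter m T] lies in the [m]-cylinder of [y]. *)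
have one m y x : iter m (@preimage_sum R A) \1_(agree m y) x = 1.
  elim: m y => [|m ih] y; first by rewrite /= indicE mem_set.
  rewrite iterSr -[RHS](ih (T y)); congr (iter m _ _ x); apply/funext => t.
  rewrite /preimage_sum (bigD1 (y 0%N))//= big1 ?addr0.
    rewrite !indicE; congr (nat_of_bool _)%:R; apply/idP/idP; rewrite !inE.
      by move=> h i im; exact: (h i.+1).
    by move=> h; rewrite -{1}(scons_shift y); exact: agree_scons.
  move=> a ay; rewrite indicE memNset// => /(_ 0%N isT) /= ya.
  by rewrite ya eqxx in ay.
rewrite -[leRHS]mulr1 -(one n z x0) -iter_preimage_sumZ.
apply: ler_iter_preimage_sum => t; rewrite !indicE.
have [/set_mem zt|] := boolP (t \in _); last by rewrite !mulr0.
by rewrite !mulr1 ler_expR; exact/distortion/agree_sym.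
Qed.

Lemma transfer_agree_ge n z :
  expR (birkhoff phi n z - V) <= transfer phi n \1_(agree n z) x0.
Proof.
rewrite -[leLHS]mulr1.
have zz : \1_(agree n z) z = 1 :> R by rewrite indicE mem_set.
rewrite -[X in _ * X]zz; apply: (transfer_cylinder_ge distortion) => [t|].
  by rewrite indicE.
exact/depends_on_indic/depends_on_agree.
Qed.

Lemma gibbs_cylinder nu n z : gibbs_measure nu ->
  `|ln (fine (nu (agree n z))) - (birkhoff phi n z - ln (Z n))| <= 5 * V.
Proof.
move=> gnu; have [le1 le2] := gnu n _ (@depends_on_agree _ n z).
have Z0 : 0 < Z n by exact: transfer1_gt0 distortion _ _.
have D0 : 0 < expR V ^+ 4 by rewrite exprn_gt0 ?expR_gt0.
have L0 : 0 < transfer phi n \1_(agree n z) x0.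
  exact: lt_le_trans (expR_gt0 _) (transfer_agree_ge n z).
have nu0 : 0 < fine (nu (agree n z)).
  by rewrite -(pmulr_rgt0 _ D0); apply: lt_le_trans le2; rewrite divr_gt0.
have lnle (a b : R) : 0 < a -> a <= b -> ln a <= ln b.
  by move=> a0 ab; rewrite ler_ln ?posrE//; exact: lt_le_trans ab.
have := lnle _ _ L0 (transfer_agree_le n z); rewrite expRK => h1.
have := lnle _ _ (expR_gt0 _) (transfer_agree_ge n z); rewrite expRK => h2.
have LZ0 : 0 < transfer phi n \1_(agree n z) x0 / Z n by rewrite divr_gt0.
have := lnle _ _ nu0 le1; have := lnle _ _ LZ0 le2.
have -> : ln (expR V ^+ 4 * fine (nu (agree n z))) =
    4 * V + ln (fine (nu (agree n z))) by rewrite lnM// -expRM_natl expRK.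
have -> : ln (expR V ^+ 4 * (transfer phi n \1_(agree n z) x0 / Z n)) =
    4 * V + ln (transfer phi n \1_(agree n z) x0 / Z n).
  by rewrite lnM// -expRM_natl expRK.
rewrite ln_div// => h3 h4.
by rewrite ler_norml; apply/andP; split; lra.
Qed.

(** The partition by the first letter suffices: the atoms of its joins are cylinders, whose measures
    the Gibbs property gives up to a bounded factor. *)
Lemma ks_entropy_ge nu : invariant_measure T nu -> gibbs_measure nu ->
  ((P - \int[nu]_x phi x)%:E <= ks_entropy T nu)%E.
Proof.
move=> invnu gnu; apply: ereal_sup_ubound.
pose Q (i : 'I_#|A|) := [set x : full_shift A | x 0%N = enum_val i].
pose lab (x : full_shift A) : 'I_#|A| := enum_rank (x 0%N : A).
have labQ i x : Q i x <-> lab x = i.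
  by rewrite /Q /lab /=; split=> [->|<-]; rewrite ?enum_valK// enum_rankK.
have mQ i : measurable (Q i).
  by apply: (@depends_on_measurable _ 1) => x y xy; rewrite /Q/= xy.
have partQ : partition [set: 'I_#|A|] Q setT.
  split.
  - rewrite eqEsubset; split=> // x _; exists (lab x) => //; exact/labQ.
  - by move=> i j _ _ [x [/labQ <- /labQ <-]].
  - by move=> i _; exists (fun=> enum_val i).
exists #|A|, Q; split=> //; congr EFin; apply/esym.
(* [5 * V] comes from [gibbs_cylinder] and [2 * V] from [rate]. *)
apply/cvg_lim => //; apply: (@cvg_average _ _ _ (7 * V)) => n.
have joinE z : join_iter T Q (itinerary lab n z) = agree n z.
  rewrite (join_iterE labQ) eqEsubset; split=> x /=.
    move=> /ffunP xz i ni; have := xz (Ordinal ni).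
    by rewrite !ffunE /lab/= => /enum_rank_inj; rewrite !iter_shiftE addn0.
  move=> zx; apply/ffunP => i; rewrite !ffunE /lab !iter_shiftE.
  by rewrite zx// addn0.
have [bG EG] := Rintegral_itinerary nu mQ labQ
  (fun w : {ffun 'I_n -> 'I_#|A|} => - ln (fine (nu (join_iter T Q w)))).
have -> : shannon_entropy nu (@join_iter _ _ T _ Q n) =
    \int[nu]_z - ln (fine (nu (join_iter T Q (itinerary lab n z)))).
  rewrite EG /shannon_entropy -sumrN; apply: eq_bigr => w _.
  by rewrite mulNr mulrC.
have bS := bounded_measurable_birkhoff bphi n.
have bh c : bounded_measurable (fun z => c + - 1 * birkhoff phi n z).
  exact: bounded_measurableD (bounded_measurable_cst _ c) (bounded_measurableZ _ bS).
have Eh c : \int[nu]_z (c + - 1 * birkhoff phi n z) = c - n%:R * \int[nu]_x phi x.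
  rewrite bounded_RintegralD ?Rintegral_probability_cst ?bounded_RintegralZ//.
  - by rewrite (Rintegral_birkhoff bphi invnu) mulN1r.
  - exact: bounded_measurable_cst.
  - exact: bounded_measurableZ.
have : \int[nu]_z (ln (Z n) - 5 * V + - 1 * birkhoff phi n z) <=
    \int[nu]_z - ln (fine (nu (join_iter T Q (itinerary lab n z)))).
  apply: le_bounded_Rintegral => // z; rewrite joinE.
  by have := gibbs_cylinder n z gnu; rewrite ler_norml => /andP[]; lra.
have : \int[nu]_z - ln (fine (nu (join_iter T Q (itinerary lab n z)))) <=
    \int[nu]_z (ln (Z n) + 5 * V + - 1 * birkhoff phi n z).
  apply: le_bounded_Rintegral => // z; rewrite joinE.
  by have := gibbs_cylinder n z gnu; rewrite ler_norml => /andP[]; lra.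
rewrite !Eh mulrBr => h1 h2; have := rate n; rewrite !ler_norml => /andP[h3 h4].
by apply/andP; split; lra.
Qed.

Lemma integral_potential_EFin nu : (\int[nu]_x (phi x)%:E)%E = (\int[nu]_x phi x)%:E.
Proof.
rewrite /Rintegral fineK//; apply: integrable_fin_num => //.
exact: bounded_measurable_integrable.
Qed.

Lemma gibbs_equilibrium nu : invariant_measure T nu -> gibbs_measure nu ->
  equilibrium_state phi nu.
Proof.
move=> invnu gnu; split=> // nu' invnu'; rewrite /free_energy.
rewrite !integral_potential_EFin.
apply: (@le_trans _ _ P%:E).
  by have := leeD2r (\int[nu']_x phi x)%:E (ks_entropy_le invnu');
     rewrite -EFinD subrK.
by have := leeD2r (\int[nu]_x phi x)%:E (ks_entropy_ge invnu gnu);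
   rewrite -EFinD subrK.
Qed.

(** The charge is invariant on clopen sets, which are stable under intersection and generate the
    Borel sets, so its extension and the pushforward of the extension coincide. *)
Lemma gibbs_measure_exists :
  exists nu, invariant_measure T nu /\ gibbs_measure nu.
Proof.
have [p [p0 pT pU pinv pgibbs]] := gibbs_charge distortion x0.
have [nu nup] := charge_extension p0 pT pU.
exists nu; split; last first.
  by move=> n C nC; rewrite (nup _ _ nC); exact: pgibbs.
move=> B mB; pose G := [set C : set (full_shift A) | exists n, depends_on n C].
have mT := @measurable_shift A.
rewrite -[LHS]/(pushforward nu T B).
apply: (measure_unique G (fun=> setT)) => //.
- exact: measurable_full_shiftE.
- move=> C C' [n nC] [n' nC']; exists (maxn n n') => x y xy.
  congr (_ /\ _); first exact/nC/(agree_le (leq_maxl _ _) xy).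
  exact/nC'/(agree_le (leq_maxr _ _) xy).
- by exists 0%N.
- by rewrite bigcup_const//; exists 0%N.
- move=> C [n nC]; rewrite /= /pushforward (nup n C nC) (nup n.+1) ?pinv//.
  by move=> x y xy; rewrite /preimage/=; apply: nC => i ni; exact: xy.
- by move=> _; rewrite /= /pushforward preimage_setT probability_setT ltry.
Qed.

End gibbs_measures.

(** * Bounded distortion from the decay of the variations *)

Section regular_potentials.
Context (R : realType) (A : pfinType) (phi : full_shift A -> R).
Hypothesis cphi : continuous phi.

Lemma continuous_bounded_measurable : bounded_measurable phi.
Proof.
split.
  apply: (measurability (@RGenOpens.G R) (RGenOpens.measurableE R)).
  move=> _ [_ [a [b ->]] <-]; rewrite setTI; apply: sub_sigma_algebra.
  by move/continuousP : cphi; apply; exact: interval_open.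
have : compact (phi @` setT).
  apply: continuous_compact; last exact: full_shift_compact.
  exact: continuous_subspaceT.
move=> /compact_bounded [M [_ /(_ (M + 1))]].
rewrite ltrDl ltr01 => /(_ isT) phiM.
by exists (M + 1) => x; apply: phiM; exists x.
Qed.

Lemma le_potential_var n x y :
  agree n x y -> `|phi x - phi y| <= potential_var phi n.
Proof.
have [_ [c phic]] := continuous_bounded_measurable.
move=> xy; apply: sup_ubound; last by exists x, y.
exists (c + c) => _ [z [t [_ ->]]].
by rewrite (le_trans (ler_normB _ _))// lerD.
Qed.

Variable alpha : R.
Hypothesis alpha2 : 2 < alpha.
Hypothesis varO :
  (potential_var phi : nat -> R) =O_\oo (fun n : nat => n%:R `^ (- alpha)).

Lemma potential_var_summable :
  exists V, forall n, \sum_(i < n) potential_var phi i.+1 <= V.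
Proof.
have [_ [c phic]] := continuous_bounded_measurable.
have var_le n : potential_var phi n <= c + c.
  apply: ge_sup; first by exists 0, point, point; split=> //; rewrite subrr normr0.
  by move=> _ [z [t [_ ->]]]; rewrite (le_trans (ler_normB _ _))// lerD.
have c0 : 0 <= c by exact: le_trans (phic point).
have /eqO_exP [K K0 [n0 _ HK]] := varO.
(* The second summand takes care of the orders below [n0], where only the trivial bound [c + c] on
   the variation is available. *)
pose K' := K + (c + c) * n0%:R ^+ 2.
have cn0 : 0 <= (c + c) * n0%:R ^+ 2 by rewrite mulr_ge0 ?addr_ge0 ?sqr_ge0.
have KK' : K <= K' by rewrite lerDl.
have K'0 : 0 <= K' by exact: le_trans (ltW K0) KK'.
have wK i : potential_var phi i.+1 <= K' * (i.+1%:R ^+ 2)^-1.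
  have i0 : 0 < i.+1%:R ^+ 2 :> R by rewrite exprn_gt0.
  have [ni|ni] := leqP n0 i.+1.
    apply: (@le_trans _ _ (K * (i.+1%:R ^+ 2)^-1)).
      apply: le_trans (ler_norm _) _; apply: le_trans (HK _ ni) _.
      rewrite ger0_norm ?powR_ge0// ler_pM2l// -powR_mulrn// -powRN.
      by rewrite ler_powR ?ler1n// lerN2 ltW.
    by apply: ler_wpM2r => //; rewrite invr_ge0 ltW.
  rewrite ler_pdivlMr//.
  apply: (@le_trans _ _ ((c + c) * n0%:R ^+ 2)); last by rewrite lerDr ltW.
  apply: ler_pM; [|exact: ltW|exact: var_le|].
    exact: le_trans (normr_ge0 _) (le_potential_var (@agree_refl _ i.+1 point)).
  by rewrite lerXn2r ?nnegrE// ler_nat ltnW.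
(* A telescoping bound; at [m = 0] it holds through the convention that the inverse of 0 is 0. *)
have sumV m : \sum_(i < m) (i.+1%:R ^+ 2)^-1 <= 2 - m%:R^-1 :> R.
  elim: m => [|[|m] ih]; first by rewrite big_ord0 invr0 subr0.
    by rewrite big_ord_recr big_ord0/= expr1n invr1; lra.
  rewrite big_ord_recr/= (le_trans (lerD ih (lexx _)))//.
  rewrite -addrA lerD2l -subr_ge0 -(natr1 m.+1).
  have : 0 < m.+1%:R :> R by [].
  move: (m.+1%:R : R) => a a0; have a10 : 0 < a + 1 by rewrite addr_gt0.
  rewrite (_ : _ - _ = (a * (a + 1) ^+ 2)^-1).
    by rewrite invr_ge0 mulr_ge0 ?ltW// exprn_gt0.
  by field; rewrite !gt_eqF.
exists (K' * 2) => n.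
apply: (@le_trans _ _ (\sum_(i < n) K' * (i.+1%:R ^+ 2)^-1)).
  by apply: ler_sum => i _; exact: wK.
rewrite -mulr_sumr ler_wpM2l//.
by rewrite (le_trans (sumV n))// gerBl invr_ge0.
Qed.

(** After [i] shifts, two points of an [n]-cylinder still agree on [n - i] coordinates; read
    backwards, the differences are bounded by the variations of orders 1 to [n], which are
    summable. *)
Lemma birkhoff_distortion :
  exists V, forall n x y, agree n x y -> birkhoff phi n x <= birkhoff phi n y + V.
Proof.
have [V varV] := potential_var_summable.
exists V => n x y xy; rewrite -lerBlDl -sumrB (le_trans _ (varV n))//.
rewrite (reindex_inj rev_ord_inj)/=; apply: ler_sum => i _.
apply: le_trans (ler_norm _) (le_potential_var _).
by apply: agree_iter_shift; rewrite subnK.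
Qed.

End regular_potentials.

(** * Hitting times: order, logarithms and measurability *)

Section hitting_times.
Context (R : realType) (A : pfinType).
Implicit Types x y : full_shift A.
Notation T := (@shift_map A).

Definition hits_at n j x y := forall i, (i < n)%N -> y (j + i)%N = x i.

Lemma hits_atE n j x y : hits_at n j x y <-> agree n x (iter j T y).
Proof.
by split=> h i ni; [rewrite iter_shiftE h|rewrite h// iter_shiftE].
Qed.

Lemma le_hitting_time n x y (t : \bar R) : (t <= hitting_time R n x y)%E <->
  forall j, (1 <= j)%N -> hits_at n j x y -> (t <= j%:R%:E)%E.
Proof.
split=> [th j j1 hj|h].
  by apply: le_trans th _; apply: ereal_inf_lbound; exists j.
by apply: le_ereal_inf_tmp => _ [j [j1 hj] <-]; exact: h.
Qed.

Lemma hitting_time_ge1 n x y : (1 <= hitting_time R n x y)%E.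
Proof. by apply/le_hitting_time => j j1 _; rewrite lee_fin ler1n. Qed.

Lemma log_hitting_time_ge0 n x y :
  (0 <= (n%:R^-1)%:E * lne (hitting_time R n x y))%E.
Proof.
by rewrite mule_ge0// ?lee_fin ?invr_ge0// lne_ge0 hitting_time_ge1.
Qed.

Lemma le_log_hitting_time n x y (v : R) : (0 < n)%N ->
  (v%:E <= (n%:R^-1)%:E * lne (hitting_time R n x y))%E =
  ((expR (n%:R * v))%:E <= hitting_time R n x y)%E.
Proof.
move=> n0; have n0' : 0 < n%:R :> R by rewrite ltr0n.
have := hitting_time_ge1 n x y.
case: hitting_time => [r| |]//; last first.
  by rewrite /= mulry gtr0_sg ?invr_gt0// mul1e !leey.
rewrite lee_fin => r1; have r0 : 0 < r by exact: lt_le_trans r1.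
rewrite lne_EFin// -EFinM !lee_fin ler_pdivlMl//.
by rewrite -[in RHS](lnK (r0 : r \is Num.pos)) ler_expR.
Qed.

Lemma measurable_hits_at n j :
  measurable [set xy : full_shift A * full_shift A | hits_at n j xy.1 xy.2].
Proof.
rewrite (_ : [set xy | _] = \bigcap_(i in [set i | (i < n)%N])
    \bigcup_(a in [set: A]) ([set x : full_shift A | x i = a] `*`
      [set y : full_shift A | y (j + i)%N = a])).
  apply: bigcap_measurableType => i _; apply: fin_bigcup_measurable.
    exact: finite_finset.
  move=> a _; apply: measurableX.
    by apply: (@depends_on_measurable _ i.+1) => x y xy; rewrite /= xy.
  by apply: (@depends_on_measurable _ (j + i).+1) => x y xy; rewrite /= xy.
rewrite eqEsubset; split=> -[x y] /= h i.
  by move=> ni; exists (x i) => //; split=> //=; rewrite h.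
by move=> ni; have [a _ [/= -> ->]] := h i ni.
Qed.

Lemma measurable_hitting_time_ge n (t : R) :
  measurable [set xy : full_shift A * full_shift A |
    (t%:E <= hitting_time R n xy.1 xy.2)%E].
Proof.
rewrite (_ : [set xy | _] = \bigcap_(j in [set j | (1 <= j)%N /\ j%:R < t])
    ~` [set xy : full_shift A * full_shift A | hits_at n j xy.1 xy.2]).
  apply: bigcap_measurableType => j _; apply: measurableC.
  exact: measurable_hits_at.
rewrite eqEsubset; split=> -[x y] /=.
  by move=> /le_hitting_time h j [j1 jt] /(h _ j1); rewrite lee_fin leNgt jt.
move=> h; apply/le_hitting_time => j j1 hj; rewrite lee_fin leNgt.
by apply/negP => jt; exact: h hj.
Qed.

End hitting_times.

(** * Exponential tail of the hitting time of a word *)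

Section upper_tail.
Context (R : realType) (A : pfinType) (phi : full_shift A -> R) (V : R).
Hypothesis distortion :
  forall n x y, agree n x y -> birkhoff phi n x <= birkhoff phi n y + V.
Hypothesis bphi : bounded_measurable phi.
Variable x0 : full_shift A.
Notation T := (@shift_map A).
Notation Z n := (transfer phi n (cst 1) x0).
Variable P : R.
Hypothesis rate : forall n, `|ln (Z n) - n%:R * P| <= 2 * V.
Variable nu : probability (full_shift A) R.
Hypothesis gibbs : gibbs_measure phi V x0 nu.

Let V0 : 0 <= V.
Proof. by have := distortion (@agree_refl _ 0 x0); rewrite lerDl. Qed.

Let Z0 n : 0 < Z n. Proof. exact: transfer1_gt0 distortion _ _. Qed.

(** The transfer of [m + n] steps splits at time [m]; distortion then bounds it below by the
    transfer of [C] at [x0] times the weight of the cylinder of [x], which is at least exponentially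
    small as [phi] is bounded. *)
Lemma gibbs_conditional_ge : exists2 b, 0 <= b & forall m n x C, (0 < n)%N ->
  depends_on m C -> expR (- (n%:R * b)) * fine (nu C) <=
    fine (nu (C `&` iter m T @^-1` (agree n x))).
Proof.
have [_ [c phic]] := bphi.
have c0 : 0 <= c by exact: le_trans (phic x0).
(* The 14 is 4 + 4 for the two uses of the Gibbs property, 4 for comparing [Z (m + n)] with [Z m],
   and 1 + 1 for distortion and the cylinder weight. Since [n >= 1], these constants fit into
   [n * b]. *)
exists (14 * V + c + `|P|) => [|m n x C n0 mC].
  by rewrite !addr_ge0 ?mulr_ge0.
set B := C `&` _.
have mnB : depends_on (m + n) B.
  move=> y z yz; congr (_ /\ _).
    by apply: mC; apply: agree_le yz; exact: leq_addr.
  exact: (depends_on_comp_shift (@depends_on_agree _ n x)).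
have C0 (D : set (full_shift A)) z : 0 <= \1_D z :> R by rewrite indicE.
have LB : expR (- V) * transfer phi m \1_C x0 * expR (birkhoff phi n x - V)
    <= transfer phi (m + n) \1_B x0.
  rewrite transferD (_ : \1_B = fun z => \1_C z * \1_(agree n x) (iter m T z)).
    have -> : transfer phi m (fun z => \1_C z * \1_(agree n x) (iter m T z)) =
        fun z => transfer phi m \1_C z * \1_(agree n x) z.
      by apply/funext => z; rewrite transfer_mul_comp.
    apply: (@le_trans _ _ (transfer phi n (fun z =>
        expR (- V) * transfer phi m \1_C x0 * \1_(agree n x) z) x0)).
      rewrite transferZ; apply: ler_wpM2l; last exact: transfer_agree_ge.
      by rewrite mulr_ge0 ?expR_ge0// transfer_ge0.
    apply: ler_transfer => z; apply: ler_wpM2r => //.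
    rewrite expRN ler_pdivrMl ?expR_gt0//.
    exact: (transfer_distortion distortion _ _ (C0 C) (depends_on_indic R mC)).
  by apply/funext => z; rewrite /B indicI.
have birk : - (n%:R * c) <= birkhoff phi n x.
  have <- : \sum_(i < n) - c = - (n%:R * c).
    by rewrite sumr_const card_ord mulNrn mulr_natl.
  by apply: ler_sum => i _; have := phic (iter i T x); rewrite ler_norml => /andP[].
have [_ gB] := gibbs mnB; have [gC _] := gibbs mC.
have LC0 : 0 <= transfer phi m \1_C x0 by exact: transfer_ge0.
have Zmn : Z (m + n) <= expR (4 * V + n%:R * P) * Z m.
  rewrite -[leLHS]lnK ?posrE// -[Z m]lnK ?posrE// -expRD ler_expR.
  have := transfer1D_bounds distortion x0 m n; have := rate n.
  by rewrite !ler_norml => /andP[_ ?] /andP[_ ?]; lra.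
have nuC0 : 0 <= fine (nu C) by exact: fine_ge0.
rewrite -(ler_pM2l (exprn_gt0 4 (expR_gt0 V))); apply: le_trans gB.
rewrite ler_pdivlMr//; apply: le_trans LB.
have gC' : fine (nu C) * Z m <= expR V ^+ 4 * transfer phi m \1_C x0.
  by move: gC; rewrite mulrA ler_pdivlMr.
apply: (@le_trans _ _ (expR V ^+ 4 * (expR (- (n%:R * (14 * V + c + `|P|))) *
    fine (nu C)) * (expR (4 * V + n%:R * P) * Z m))).
  by rewrite ler_wpM2l// !mulr_ge0 ?exprn_ge0 ?expR_ge0.
rewrite [leLHS](_ : _ = expR V ^+ 4 * expR (- (n%:R * (14 * V + c + `|P|))) *
  expR (4 * V + n%:R * P) * (fine (nu C) * Z m)); last by ring.
apply: le_trans (ler_wpM2l _ gC') _.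
  by rewrite !mulr_ge0 ?exprn_ge0 ?expR_ge0.
rewrite mulrA [leRHS]mulrAC ler_wpM2r// -!expRM_natl -!expRD ler_expR.
have n1 : 1 <= n%:R :> R by rewrite ler1n.
have : V <= n%:R * V by rewrite ler_peMl.
have : n%:R * P <= n%:R * `|P| by rewrite ler_wpM2l// ler_norm.
by lra.
Qed.

(* No occurrence of the first [n] letters of [x] in the first [K] consecutive
   blocks of length [n] of [y], starting at coordinate 1. *)
Definition avoids n K x : set (full_shift A) :=
  [set y | forall i, (i < K)%N -> ~ agree n x (iter (1 + i * n) T y)].

Lemma depends_on_avoids n K x : depends_on (1 + K * n) (avoids n K x).
Proof.
move=> y z yz; rewrite /avoids/=; apply/propext.
have e i : (i < K)%N -> agree n x (iter (1 + i * n) T y) =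
    agree n x (iter (1 + i * n) T z).
  move=> iK; apply: (depends_on_comp_shift (@depends_on_agree _ n x)).
  by apply: agree_le yz; rewrite -addnA leq_add2l addnC -mulSn leq_mul2r iK orbT.
by split=> h i iK; [rewrite -e//|rewrite e//]; exact: h.
Qed.

Lemma avoidsS n K x : avoids n K.+1 x =
  avoids n K x `\` (avoids n K x `&` iter (1 + K * n) T @^-1` (agree n x)).
Proof.
rewrite eqEsubset; split=> y.
  by move=> h; split=> [i iK|[_]]; apply: h => //; exact: ltnW.
move=> [h nh] i; rewrite ltnS leq_eqVlt => /predU1P[->|]; last exact: h.
by move=> hK; exact: nh.
Qed.

(** Given the coordinates already read, each further block shows the word with conditional
    probability at least [expR (- (n * b))], so the measure shrinks by a fixed factor per block. *)
Lemma avoids_measure_le : exists2 b, 0 <= b & forall n K x, (0 < n)%N ->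
  (nu (avoids n K x) <= ((1 - expR (- (n%:R * b))) ^+ K)%:E)%E.
Proof.
have [b b0 gb] := gibbs_conditional_ge; exists b => // n K x n0.
have mav K' : measurable (avoids n K' x).
  exact: depends_on_measurable (@depends_on_avoids n K' x).
rewrite -[leLHS]fineK ?fin_num_measure// lee_fin.
elim: K => [|K ih].
  by rewrite -lee_fin fineK ?fin_num_measure// probability_le1.
have mag : measurable (avoids n K x `&` iter (1 + K * n) T @^-1` (agree n x)).
  apply: measurableI => //; apply: measurable_iter_shift.
  exact: depends_on_measurable (@depends_on_agree _ n x).
rewrite avoidsS measureD//; last first.
  by rewrite (le_lt_trans (probability_le1 _ _)) ?ltry.
rewrite setIA setIid fineB ?fin_num_measure//.
have /= h := gb _ _ x _ n0 (@depends_on_avoids n K x).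
rewrite exprS.
apply: (@le_trans _ _ ((1 - expR (- (n%:R * b))) * fine (nu (avoids n K x)))).
  by rewrite mulrBl mul1r lerD2l lerN2.
by rewrite ler_wpM2l// subr_ge0 -expR0 ler_expR oppr_le0 mulr_ge0.
Qed.

Lemma hitting_time_tail : exists2 b, 0 <= b & forall n x t, (0 < n)%N -> 0 <= t ->
  (nu [set y | (t%:E <= hitting_time R n x y)%E] <=
    (expR (2 - expR (- (n%:R * b)) * (t / n%:R)))%:E)%E.
Proof.
have [b b0 avb] := avoids_measure_le; exists b => // n x t n0 t0.
have n0' : 0 < n%:R :> R by rewrite ltr0n.
(* As blocks start at coordinate 1, one block is given up to keep all starting positions [1 + i * n]
   below [t]. Rounding and this loss give [K >= t / n - 2], whence the 2 in the exponent. *)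
pose M := Num.truncn (t / n%:R); pose K := M.-1.
have tn0 : 0 <= t / n%:R by rewrite divr_ge0// ltW.
have /andP[Mt tM] : M%:R <= t / n%:R < M.+1%:R by exact: Num.Theory.truncn_itv.
pose r : R := expR (- (n%:R * b)).
have r1 : 0 <= 1 - r by rewrite subr_ge0 -expR0 ler_expR oppr_le0 mulr_ge0.
have r0 : 0 < r by exact: expR_gt0.
have sub : [set y | (t%:E <= hitting_time R n x y)%E] `<=` avoids n K x.
  move=> y /= /le_hitting_time h i iK hi.
  have := h (1 + i * n)%N isT ((hits_atE _ _ _ _).2 hi).
  rewrite lee_fin leNgt => /negP; apply.
  rewrite ler_pdivlMr// -natrM in Mt; apply: lt_le_trans Mt.
  rewrite ltr_nat (@leq_trans ((i + 2) * n))//.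
    by rewrite mulnDl addnC ltn_add2l; lia.
  by rewrite leq_mul2r; apply/orP; right; move: iK; rewrite /K; lia.
have mS : measurable [set y | (t%:E <= hitting_time R n x y)%E].
  have := measurable_xsection x (@measurable_hitting_time_ge R A n t).
  by rewrite (_ : xsection _ x = [set y | (t%:E <= hitting_time R n x y)%E])//
    /xsection; apply/funext => y /=; rewrite inE.
apply: (@le_trans _ _ (nu (avoids n K x))).
  apply: le_measure => //; rewrite inE//.
  exact: depends_on_measurable (@depends_on_avoids n K x).
apply: le_trans (avb n K x n0) _; rewrite lee_fin -/r.
apply: (@le_trans _ _ (expR (- r) ^+ K)).
  by rewrite lerXn2r ?nnegrE ?expR_ge0// -[leLHS]/(1 + - r) expR_ge1Dx.
rewrite -expRM_natl ler_expR.
have : t / n%:R - 2 <= K%:R.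
  rewrite lerBlDr (le_trans (ltW tM))// -natrD ler_nat /K; lia.
have : r <= 1 by rewrite -subr_ge0.
by nra.
Qed.

End upper_tail.

(** * The two deviation estimates *)

Theorem theorem3p7 (R : realType) (A : pfinType) (phi : full_shift A -> R)
    (alpha : R) (mu : probability (full_shift A) R) :
  continuous phi ->
  2 < alpha ->
  (potential_var phi : nat -> R) =O_\oo (fun n : nat => n%:R `^ (- alpha)) ->
  unique_equilibrium_state phi mu ->
  exists c1 c2 u0 : R, [/\ 0 < c1, 0 < c2, 0 < u0 &
    forall (n : nat) (u : R), (1 <= n)%N -> u0 < u ->
      ((mu \x mu) [set xy : (full_shift A * full_shift A)%type |
          ks_entropy (@shift_map A) mu + u%:E
            <= (n%:R^-1)%:E * lne (hitting_time R n xy.1 xy.2)]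
        <= (c1 * expR (- c2 * n%:R * u ^+ 2))%:E)%E
      /\
      ((mu \x mu) [set xy : (full_shift A * full_shift A)%type |
          (n%:R^-1)%:E * lne (hitting_time R n xy.1 xy.2)
            <= ks_entropy (@shift_map A) mu - u%:E]
        <= (c1 * expR (- c2 * n%:R * u))%:E)%E].
Proof.
move=> cphi alpha2 varO [[invmu eqmu] uniqmu].
have bphi := continuous_bounded_measurable cphi.
have [V distortion] := birkhoff_distortion cphi alpha2 varO.
pose x0 : full_shift A := point.
have [P rate] := quasi_additive_rate (transfer1D_bounds distortion x0).
have gibbs : gibbs_measure phi V x0 mu.
  have [nu [invnu gnu]] := gibbs_measure_exists distortion x0.
  have numu := uniqmu nu (gibbs_equilibrium distortion bphi rate invnu gnu).
  move=> m C mC; rewrite -(numu C (depends_on_measurable mC)).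
  exact: gnu.
pose h := P - \int[mu]_x phi x.
have -> : ks_entropy (@shift_map A) mu = h%:E.
  apply/eqP; rewrite eq_le (ks_entropy_le distortion bphi rate invmu).
  exact: (ks_entropy_ge distortion bphi rate invmu gibbs).
have [b b0 tail] := hitting_time_tail distortion bphi rate gibbs.
(* [expR 2] is the prefactor in [hitting_time_tail]. The threshold ensures [h - u < 0], [u >= 1] and
   [u / 4 + b <= h + u]. *)
exists (expR 2), (384%:R^-1), (2 * `|h| + 4 * b + 1); split.
- exact: expR_gt0.
- by rewrite invr_gt0 ltr0n.
- by rewrite !ltr_wpDl// ?addr_ge0 ?mulr_ge0.
move=> n u n1 u_gt; have := ler_norm (- h); rewrite normrN => h_ge.
have h0 : 0 <= `|h| by [].
have hu : h - u < 0 by have := ler_norm h; lra.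
split; last first.
  (* The lower event is empty: the logarithm of a hitting time is nonnegative, while [h - u] is
     negative. *)
  rewrite (_ : [set xy | _] = set0) ?measure0 ?lee_fin ?mulr_ge0 ?expR_ge0//.
  rewrite -subset0 => -[x y] /=.
  by move/(le_trans (log_hitting_time_ge0 R n x y)); rewrite lee_fin leNgt hu.
have n0 : 0 < n%:R :> R by rewrite ltr0n.
set S := [set xy | _].
(* The constant 384 = 6 * 4 ^ 3 comes from [expR z >= z ^+ 3 / 6] at
   [z = n * u / 4]. *)
have SE : S = [set xy |
    ((expR (n%:R * (h + u)))%:E <= hitting_time R n xy.1 xy.2)%E].
  by apply/funext => xy; rewrite /S/= -EFinD le_log_hitting_time.
have mS : measurable S by rewrite SE; exact: measurable_hitting_time_ge.
have secS x : (mu (xsection S x) <=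
    (expR 2 * expR (- 384%:R^-1 * n%:R * u ^+ 2))%:E)%E.
  rewrite (_ : xsection S x =
      [set y | ((expR (n%:R * (h + u)))%:E <= hitting_time R n x y)%E]); last first.
    by rewrite SE /xsection; apply/funext => y /=; rewrite inE.
  apply: le_trans (tail n x _ n1 (expR_ge0 _)) _.
  rewrite lee_fin -expRD ler_expR lerD2l mulNr mulNr lerN2 [leRHS]mulrA -expRD.
  rewrite ler_pdivlMr//.
  (* Clearing the division by [n] in the tail leaves [(n * u) ^+ 2 / 384] to be bounded. The cubic
     term of the exponential suffices, as [n * u >= 1]. *)
  apply: (@le_trans _ _ (expR (n%:R * u / 4))); last first.
    rewrite ler_expR.
    have : n%:R * (u / 4 + b) <= n%:R * (h + u) by rewrite ler_pM2l//; lra.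
    by lra.
  have u1 : 1 <= u by lra.
  have n1' : 1 <= n%:R :> R by rewrite ler1n.
  have z0 : 0 <= n%:R * u / 4 by rewrite divr_ge0// mulr_ge0; lra.
  have := @expR_ge1Dxn R _ 2 z0.
  rewrite (_ : 3`!%:R = 6 :> R)//.
  have nu2 : 0 <= n%:R ^+ 2 * u ^+ 2 by rewrite mulr_ge0// sqr_ge0.
  have : n%:R ^+ 2 * u ^+ 2 <= n%:R ^+ 2 * u ^+ 2 * (n%:R * u).
    by rewrite ler_peMr// -[leLHS]mulr1 ler_pM//; lra.
  by rewrite !expr2 !exprS !expr0; lra.
(* The bound on the sections is uniform in [x], so integrating it over the first factor only
   multiplies it by the total mass 1. *)
rewrite /product_measure1.
apply: (@le_trans _ _
  (\int[mu]_x (expR 2 * expR (- 384%:R^-1 * n%:R * u ^+ 2))%:E)%E).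
  apply: ge0_le_integral => //.
  - exact: measurable_fun_xsection.
  - by move=> x _; exact: secS.
by rewrite integral_cst//= [X in (_ * X)%E]probability_setT mule1.
Qed.
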